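(* Let $p\ge 3$ be an integer. Then for all sufficiently large $n$, $SPEX_P(n,B_p)=\{2K_1+C_{n-2}\}$, where $B_p=K_2+I_p$.
   Context: All graphs are finite and simple. A graph is $F$-free if it has no subgraph isomorphic to $F$. The spectral radius of a graph is the largest eigenvalue of its adjacency matrix. $SPEX_P(n,F)$ denotes the set of $n$-vertex $F$-free planar graphs whose spectral radius is maximum among all $n$-vertex $F$-free planar graphs (up to isomorphism). $K_m$, $C_m$, $I_m$ denote the complete graph, cycle and edgeless graph on $m$ vertices. The join $G_1+G_2$ of vertex-disjoint graphs is obtained from $G_1\cup G_2$ by adding all edges between $V(G_1)$ and $V(G_2)$. The book $B_p=K_2+I_p$ has $p+2$ vertices. *)

(* Defs.v *)
From HB Require Import structures.
From mathcomp Require Import all_boot all_order all_algebra.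
From mathcomp Require Import all_classical all_reals all_analysis.
Import Order.TTheory GRing.Theory Num.Theory.
Import numFieldNormedType.Exports.

Set Implicit Arguments.
Unset Strict Implicit.
Unset Printing Implicit Defensive.

Local Open Scope classical_set_scope.
Local Open Scope ring_scope.

Record sgraph : Type := SGraph {
  vertex :> finType;
  adj : rel vertex;
  adj_sym : symmetric adj;
  adj_irrefl : irreflexive adj }.

Definition sgraph_iso (G H : sgraph) : Prop :=
  exists2 f : G -> H, bijective f & forall x y, adj (f x) (f y) = adj x y.

(* Subgraphs need not be induced, so f is only required to preserve edges. *)
Definition contains (F G : sgraph) : Prop :=
  exists2 f : F -> G, injective f & forall x y, adj x y -> adj (f x) (f y).

Definition is_free (F G : sgraph) : Prop := ~ contains F G.

Section Constructions.
Local Open Scope nat_scope.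

Definition complete_rel m : rel 'I_m := fun i j => i != j.
Fact complete_sym m : symmetric (@complete_rel m).
Proof. by move=> i j; rewrite /complete_rel eq_sym. Qed.
Fact complete_irrefl m : irreflexive (@complete_rel m).
Proof. by move=> i; rewrite /complete_rel eqxx. Qed.
Definition complete m : sgraph := SGraph (@complete_sym m) (@complete_irrefl m).

Definition edgeless_rel m : rel 'I_m := fun _ _ => false.
Fact edgeless_sym m : symmetric (@edgeless_rel m). Proof. by []. Qed.
Fact edgeless_irrefl m : irreflexive (@edgeless_rel m). Proof. by []. Qed.
Definition edgeless m : sgraph := SGraph (@edgeless_sym m) (@edgeless_irrefl m).

(* This is the cycle C_m for 3 <= m; for m < 3 it is complete m. *)
Definition cycle_rel m : rel 'I_m :=
  fun i j => (i != j) && ((j == i.+1 %% m :> nat) || (i == j.+1 %% m :> nat)).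
Fact cycle_sym m : symmetric (@cycle_rel m).
Proof. by move=> i j; rewrite /cycle_rel eq_sym orbC. Qed.
Fact cycle_irrefl m : irreflexive (@cycle_rel m).
Proof. by move=> i; rewrite /cycle_rel eqxx. Qed.
Definition cycle_graph m : sgraph := SGraph (@cycle_sym m) (@cycle_irrefl m).

Definition dunion_rel (G H : sgraph) : rel (G + H)%type := fun u v =>
  match u, v with
  | inl x, inl y => adj x y
  | inr x, inr y => adj x y
  | _, _ => false
  end.
Fact dunion_sym G H : symmetric (@dunion_rel G H).
Proof. by case=> x [] y //=; apply: adj_sym. Qed.
Fact dunion_irrefl G H : irreflexive (@dunion_rel G H).
Proof. by case=> x /=; apply: adj_irrefl. Qed.
Definition dunion (G H : sgraph) : sgraph :=
  SGraph (@dunion_sym G H) (@dunion_irrefl G H).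

Definition join_rel (G H : sgraph) : rel (G + H)%type := fun u v =>
  match u, v with
  | inl x, inl y => adj x y
  | inr x, inr y => adj x y
  | _, _ => true
  end.
Fact join_sym G H : symmetric (@join_rel G H).
Proof. by case=> x [] y //=; apply: adj_sym. Qed.
Fact join_irrefl G H : irreflexive (@join_rel G H).
Proof. by case=> x /=; apply: adj_irrefl. Qed.
Definition join (G H : sgraph) : sgraph :=
  SGraph (@join_sym G H) (@join_irrefl G H).

Definition book p : sgraph := join (complete 2) (edgeless p).

End Constructions.

Section Planarity.
Variable R : realType.

Definition is_arc (A : set (R * R)) (a b : R * R) : Prop :=
  exists g : R -> R * R,
    [/\ {within `[0, 1]%classic, continuous g},
        {in `[0, 1] &, injective g},
        g 0 = a, g 1 = b & A = g @` `[0, 1]%classic].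

(* A drawing of G in the plane: arc e is the curve drawn for the edge with
   end set e, and its values at other sets are irrelevant.  By the last two
   conditions, two distinct edges meet only in the images of common ends. *)
Definition plane_drawing (G : sgraph)
    (pos : G -> R * R) (arc : {set G} -> set (R * R)) : Prop :=
  [/\ injective pos,
      forall x y, adj x y -> is_arc (arc [set x; y]%SET) (pos x) (pos y),
      forall x y z, adj x y -> arc [set x; y]%SET (pos z) -> z = x \/ z = y
    & forall x y u v, adj x y -> adj u v ->
        [set x; y]%SET != [set u; v]%SET ->
        arc [set x; y]%SET `&` arc [set u; v]%SET `<=` range pos].

Definition planar (G : sgraph) : Prop :=
  exists pos : G -> R * R, exists arc : {set G} -> set (R * R),
    plane_drawing pos arc.

End Planarity.

Section Spectrum.
Variable R : realType.

Definition adjacency (G : sgraph) : 'M[R]_#|G| :=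
  \matrix_(i, j) (adj (enum_val i) (enum_val j))%:R.

(* The adjacency matrix is real symmetric, so all its eigenvalues lie in R;
   they are finitely many, so for nonempty G the supremum is a maximum. *)
Definition spectral_radius (G : sgraph) : R :=
  sup [set a : R | eigenvalue (adjacency G) a].

(* SPEX_P R n F G says that G belongs to the class; as the class is taken up
   to isomorphism, this predicate is invariant under isomorphism of G. *)
Definition SPEX_P (n : nat) (F G : sgraph) : Prop :=
  [/\ #|G| = n, planar R G, is_free F G
    & forall H : sgraph, #|H| = n -> planar R H -> is_free F H ->
        spectral_radius H <= spectral_radius G].

End Spectrum.

(* Main.v *)
(* Let z be the absolute value of an eigenvector, so that A z >= lam z entrywise, with
   lam = 1 + sqrt (2n - 3) the spectral radius of 2K_1 + C_{n-2}.  Every set S of vertices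
   of a planar graph contains a vertex with at most 15 neighbours in S, so vertices of
   small degree contribute little to the quadratic form of A; as there is no K_{3,3},
   almost all vertices have at most two neighbours of large degree.  Comparing quadratic
   forms then produces two vertices u and v adjacent to almost all others.  They are not
   adjacent, by book-freeness.  A second energy estimate, exact up to terms that are small
   compared with the loss caused by each vertex not adjacent to both u and v, shows that
   there is no such vertex and that G - u - v is 2-regular.  It is then a single cycle,
   since a cycle and a further vertex would give a K_5 minor.

   The only topology needed is that a planar graph has no K_{3,3} subgraph and no K_5
   minor.  Round the arcs of a drawing to king walks on a fine integer lattice.  For two
   walks far from each other, counting mod 2 the crossings with the horizontal rays issued
   from the ends of the other walk gives one linear equation over F_2, and adding these
   equations over all pairs of disjoint edges of K_5 or K_{3,3} gives 0 = 1.  The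
   sparsity of planar graphs then follows by Mader's contraction argument. *)
Require Import Defs.
From mathcomp Require Import all_boot all_order all_algebra.
From mathcomp Require Import all_classical all_reals all_analysis.
From mathcomp Require Import zify ring lra.
From Stdlib Require Ring.
Import Order.TTheory GRing.Theory Num.Theory.
Import numFieldNormedType.Exports.

Set Implicit Arguments.
Unset Strict Implicit.
Unset Printing Implicit Defensive.

(** * Crossing parities of lattice walks *)

(** The inequality A z >= lam z is used with the value lam of the double wheel, not with the
    spectral radius of the graph at hand: since lam (lam - 2) = 2 (n - 2), the main terms of the
    second energy estimate cancel exactly. The bounds for planar graphs may be crude. Degeneracy 15
    only enlarges lower-order terms, because the edges that miss the vertices of large degree
    contribute a small multiple of lam; the one sharp bound, at most two rim neighbours for each
    vertex, comes from the absence of K_{3,3}. A vertex not joined to both hubs sees at most one of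
    them, hence about half of s = z u + z v. By the AM-GM inequality it adds about (s / 2)^2 / lam
    to the energy, where a rim vertex adds about s^2 / lam, and this gap pays for all the errors. *)

Section LatticeWalks.

Local Open Scope ring_scope.

Definition king (p q : int * int) : bool :=
  (`|p.1 - q.1| <= 1) && (`|p.2 - q.2| <= 1).

(** Three leaves room for one king step of each point: coordinates that differ by 3 still differ by
    at least 1 afterwards, with the same sign. *)
Definition far (p q : int * int) : bool :=
  (3 <= `|p.1 - q.1|) || (3 <= `|p.2 - q.2|).

(** [lexle p v] says that p lies below the broken line that runs at height v.2 + 1/2 up to abscissa
    v.1 + 1/2 and at height v.2 - 1/2 beyond it. *)
Definition lexle (p q : int * int) : bool :=
  (p.2 < q.2) || ((p.2 == q.2) && (p.1 <= q.1)).

(* A step is walked horizontally first, then vertically.  [step_left p q v] is the parity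
   of its crossings with the leftward ray from v + (1/2, 1/2); [step_right p q v] is the
   parity of the crossings of the step shifted by (1/2, 1/2) with the rightward ray
   from v.  The shift keeps the rays away from the ends of the steps. *)
Definition step_left (p q v : int * int) : bool :=
  ((p.2 <= v.2) (+) (q.2 <= v.2)) && (q.1 <= v.1).

Definition step_right (p q v : int * int) : bool :=
  ((p.2 < v.2) (+) (q.2 < v.2)) && (v.1 < q.1).

(** If the abscissas are far apart, both sides vanish or add the same four comparisons of heights,
    grouped by a and b on the left and by p and q on the right. If the heights are far apart, no
    comparison changes along a step and each side cancels. *)
Lemma step_cross p q a b : king p q -> king a b -> far p a ->
  step_left p q a (+) step_left p q b = step_right a b p (+) step_right a b q.
Proof.
case: p q a b => [x y] [x' y'] [i l] [i' l'].
rewrite /king /far /step_left /step_right /= => h1 h2 /orP[h|h].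
  have -> : (x' <= i) = (x' <= i') by lia.
  have -> : (x < i') = (x' <= i') by lia.
  have -> : (x' < i') = (x' <= i') by lia.
  rewrite !ltNge; case: (x' <= i'); rewrite /= ?andbF ?andbT //.
  by case: (y <= l); case: (y' <= l); case: (y <= l'); case: (y' <= l').
have -> : (y' <= l) = (y <= l) by lia.
have -> : (y' <= l') = (y <= l') by lia.
have -> : (l' < y) = (l < y) by lia.
have -> : (l' < y') = (l < y') by lia.
by rewrite !addbb.
Qed.

(** The two rays of v make up the broken line of [lexle] except for its vertical jog next to v,
    which a step far from v avoids. So the crossings with both rays tell whether the ends lie on
    different sides. *)
Lemma step_winding p q v : king p q -> far p v ->
  step_left p q v (+) step_right p q v = lexle p v (+) lexle q v.
Proof.
case: p q v => [x y] [x' y'] [i l].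
rewrite /king /far /step_left /step_right /lexle /= => h1 /orP[h|h]; last first.
  have -> : (y' <= l) = (y <= l) by lia.
  have -> : (y' < l) = (y < l) by lia.
  have -> : (y == l) = false by lia.
  have -> : (y' == l) = false by lia.
  by rewrite !addbb.
have [xi|xi] := lerP x' i; rewrite ?andbT ?andbF ?addbF ?addFb.
  have -> : (x <= i) by lia.
  by rewrite !andbT ![(_ < _) || _]orbC -!le_eqVlt.
have -> : (x <= i) = false by lia.
by rewrite !andbF !orbF.
Qed.

Definition walk_left (w : nat -> int * int) m v : bool :=
  \big[addb/false]_(k < m) step_left (w k) (w k.+1) v.

Definition walk_right (w : nat -> int * int) m v : bool :=
  \big[addb/false]_(k < m) step_right (w k) (w k.+1) v.

(** Adding [step_cross] over all pairs of steps, everything telescopes except the terms at the ends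
    of the two walks. *)
Lemma walk_cross w m w' m' :
    (forall k, (k < m)%N -> king (w k) (w k.+1)) ->
    (forall k, (k < m')%N -> king (w' k) (w' k.+1)) ->
    (forall k l, (k <= m)%N -> (l <= m')%N -> far (w k) (w' l)) ->
  walk_left w m (w' 0%N) (+) walk_left w m (w' m') =
  walk_right w' m' (w 0%N) (+) walk_right w' m' (w m).
Proof.
move=> kw kw' fw.
have step n k : (n <= m')%N -> (k < m)%N ->
    step_left (w k) (w k.+1) (w' 0%N) (+) step_left (w k) (w k.+1) (w' n) =
    walk_right w' n (w k) (+) walk_right w' n (w k.+1).
  move=> + km; elim: n => [_|n IH nm]; first by rewrite addbb /walk_right !big_ord0.
  have := IH (ltnW nm).
  rewrite /walk_right !big_ord_recr /=.
  have := step_cross (kw _ km) (kw' _ nm) (fw _ _ (ltnW km) (ltnW nm)).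
  move: (step_left _ _ _) (step_left _ _ _) (step_left _ _ _) => a b c.
  move: (step_right _ _ _) (step_right _ _ _) => d e.
  move: (\big[_/_]_(_ < _) _) (\big[_/_]_(_ < _) _) => f g.
  by case: a; case: b; case: c; case: d; case: e; case: f; case: g.
have : forall n, (n <= m)%N -> walk_left w n (w' 0%N) (+) walk_left w n (w' m') =
    walk_right w' m' (w 0%N) (+) walk_right w' m' (w n).
  elim=> [_|n IH nm]; first by rewrite addbb /walk_left !big_ord0.
  have := IH (ltnW nm); have := step _ _ (leqnn m') nm.
  rewrite /walk_left !big_ord_recr /=.
  move: (step_left _ _ _) (step_left _ _ _) => a b.
  move: (walk_right _ _ _) (walk_right _ _ _) (walk_right _ _ _) => c d e.
  move: (\big[_/_]_(_ < _) _) (\big[_/_]_(_ < _) _) => f g.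
  by case: a; case: b; case: c; case: d; case: e; case: f; case: g.
exact.
Qed.

Lemma walk_winding w m v :
    (forall k, (k < m)%N -> king (w k) (w k.+1)) ->
    (forall k, (k <= m)%N -> far (w k) v) ->
  walk_left w m v (+) walk_right w m v = lexle (w 0%N) v (+) lexle (w m) v.
Proof.
elim: m => [|m IH] kw fw; first by rewrite /walk_left /walk_right !big_ord0 !addbb.
have := step_winding (kw m (leqnn _)) (fw m (leqnSn _)).
have := IH (fun k h => kw k (leqW h)) (fun k h => fw k (leqW h)).
rewrite /walk_left /walk_right !big_ord_recr /=.
move: (step_left _ _ _) (step_right _ _ _) => a b.
move: (lexle _ _) (lexle _ _) (lexle _ _) => c d e.
move: (\big[_/_]_(_ < _) _) (\big[_/_]_(_ < _) _) => f g.
by case: a; case: b; case: c; case: d; case: e; case: f; case: g.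
Qed.

End LatticeWalks.

(** * Rounding curves to the lattice *)

Section CurveRounding.

Local Open Scope ring_scope.
Local Open Scope classical_set_scope.

Section Curves.
Variable R : realType.
Implicit Types (f h : R -> R * R) (p q : R * R) (A : set (R * R)).

(** Clamping the parameter to [0, 1] makes the curve continuous on the whole line. *)
Lemma arc_curve A p q : is_arc A p q ->
  exists f, [/\ continuous f, f 0 = p, f 1 = q & forall t, A (f t)].
Proof.
case=> g [cg _ g0 g1 ->].
pose clamp (t : R) : R := Num.max 0 (Num.min 1 t).
have clampI t : `[0, 1]%classic (clamp t).
  by rewrite /= in_itv /= /clamp le_max lexx /= ge_max ler01 ge_min lexx.
have cclamp : continuous clamp.
  move=> t; apply: continuous_max; first exact: cst_continuous.
  by apply: continuous_min; [exact: cst_continuous|exact: cvg_id].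
exists (g \o clamp); split => //=.
- move=> t; move/subspace_continuousP: cg => /(_ _ (clampI t)) cg.
  apply: cvg_comp cg.
  move=> B; rewrite /within /= => hB.
  have hB' : \forall s \near t, `[0, 1]%classic (clamp s) -> B (clamp s) by exact: cclamp t _ hB.
  have : \forall s \near t, B (clamp s) by apply: filterS hB' => s; apply.
  exact.
- by rewrite /clamp (min_idPr ler01) maxxx.
- by rewrite /clamp minxx (max_idPr ler01).
- by move=> t; exists (clamp t) => //; exact: clampI.
Qed.

Lemma curve_unif f (e : R) : continuous f -> 0 < e ->
  exists2 d : R, 0 < d & forall s t, 0 <= s <= 1 -> `|s - t| < d -> `|f s - f t| < e.
Proof.
move=> cf e0.
have /compact_near_coveringP/(_ _ (0 : R)^'+
    (fun d s => forall t, `|s - t| < d -> `|f s - f t| < e)) : compact `[0:R, 1].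
  exact: segment_compact.
move=> /(_ _)[].
  move=> s _.
  have e20 : 0 < e / 2 by lra.
  have /cvgrPdist_lt/(_ _ e20)/nbhs_ballP[r /= r0 hr] := cf s.
  exists (ball s (r/2), [set d | d < r/2]) => /=.
    split; first by apply: nbhsx_ballx; lra.
    by apply: nbhs_right_lt; lra.
  move=> [s' d] /= [hs hd] t hst.
  have h1 : `|f s - f s'| < e / 2 by apply: hr; move: hs; rewrite /ball /=; lra.
  have h2 : `|f s - f t| < e / 2.
    apply: hr; move: hs; rewrite /ball /= => hs.
    apply: le_lt_trans (ler_distD s' s t) _.
    by rewrite [r]splitr ltrD // (lt_trans hst).
  apply: le_lt_trans (ler_distD (f s) (f s') (f t)) _.
  by rewrite distrC [e]splitr ltrD.
move=> r /= r0 hr; exists (r / 2); first by lra.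
move=> s t s01; apply: (hr (r/2)) => /=; last by rewrite in_itv.
  by rewrite distrC subr0 gtr0_norm; lra.
by lra.
Qed.

Lemma curve_sep f h : continuous f -> continuous h ->
    (forall s t, 0 <= s <= 1 -> 0 <= t <= 1 -> f s <> h t) ->
  exists2 d : R, 0 < d & forall s t, 0 <= s <= 1 -> 0 <= t <= 1 -> d <= `|f s - h t|.
Proof.
move=> cf ch fh.
have [||| [s t]] := @compact_EVT_min (R * R)%type R (fun x => `|f x.1 - h x.2|)
    (`[0, 1] `*` `[0, 1]).
- by exists (0, 0) => /=; rewrite in_itv /= lexx ler01.
- by apply: compact_setX; exact: segment_compact.
- apply: continuous_subspaceT => x.
  apply: (@continuous_comp _ _ _ (fun x : R * R => f x.1 - h x.2) Num.norm); last exact: norm_continuous.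
  apply: continuousB.
    by apply: continuous_comp; [exact: cvg_fst|exact: cf].
  by apply: continuous_comp; [exact: cvg_snd|exact: ch].
rewrite inE /= !in_itv /= => -[s01 t01] hmin.
exists `|f s - h t|; first by rewrite normr_gt0 subr_eq0; apply/eqP/fh.
by move=> s' t' hs ht; apply: (hmin (s', t')); rewrite inE /= !in_itv.
Qed.

Definition lattice (N : R) p : int * int := (Num.floor (N * p.1), Num.floor (N * p.2)).

Lemma floor_near (a b : R) : `|a - b| < 1 -> `|Num.floor a - Num.floor b| <= 1.
Proof.
have := floor_itv a; have := floor_itv b.
move: (Num.floor a) (Num.floor b) => m n.
move=> /andP[h1 h2] /andP[h3 h4]; rewrite ltr_norml => /andP[h5 h6].
have : m%:~R < (n + 2)%:~R :> R by move: h2 h4; rewrite !intrD; lra.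
have : n%:~R < (m + 2)%:~R :> R by move: h2 h4; rewrite !intrD; lra.
by rewrite !ltr_int; lia.
Qed.

Lemma floor_far (a b : R) : 4 <= `|a - b| -> 3 <= `|Num.floor a - Num.floor b|.
Proof.
have := floor_itv a; have := floor_itv b.
move: (Num.floor a) (Num.floor b) => m n.
move=> /andP[h1 h2] /andP[h3 h4]; rewrite ler_normr => /orP[]h.
  have : (n + 3)%:~R < (m + 1)%:~R :> R by move: h2 h4; rewrite !intrD; lra.
  by rewrite ltr_int; lia.
have : (m + 3)%:~R < (n + 1)%:~R :> R by move: h2 h4; rewrite !intrD; lra.
by rewrite ltr_int; lia.
Qed.

Lemma pair_norm_lt p (e : R) : `|p| < e -> `|p.1| < e /\ `|p.2| < e.
Proof.
have -> : `|p| = (Num.max (`|p.1| : R) (`|p.2| : R) : R) by [].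
by rewrite gt_max => /andP.
Qed.

Lemma pair_norm_ge p (e : R) : e <= `|p| -> e <= `|p.1| \/ e <= `|p.2|.
Proof.
have -> : `|p| = (Num.max (`|p.1| : R) (`|p.2| : R) : R) by [].
by rewrite le_max => /orP.
Qed.

Lemma lattice_king N p q : 0 < N -> `|p - q| < N^-1 -> king (lattice N p) (lattice N q).
Proof.
move=> N0 /pair_norm_lt[h1 h2].
by apply/andP; split; apply: floor_near;
  rewrite -mulrBr normrM gtr0_norm // mulrC -ltr_pdivlMr // div1r.
Qed.

Lemma lattice_far N p q : 0 < N -> 4 / N <= `|p - q| -> far (lattice N p) (lattice N q).
Proof.
move=> N0 /pair_norm_ge h; apply/orP.
by case: h => h; [left|right]; apply: floor_far;
  rewrite -mulrBr normrM gtr0_norm // mulrC -ler_pdivrMr.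
Qed.

Lemma curve_walk f (N : R) : continuous f -> 0 < N ->
  exists w m, [/\ w 0%N = lattice N (f 0), w m = lattice N (f 1),
    forall k, (k < m)%N -> king (w k) (w k.+1) &
    forall k, (k <= m)%N -> exists2 t, 0 <= t <= 1 & w k = lattice N (f t)].
Proof.
move=> cf N0.
have iN0 : 0 < N^-1 by rewrite invr_gt0.
have [d d0 hd] := curve_unif cf iN0.
pose m := (Num.truncn d^-1).+1.
have md : d^-1 < m%:R by exact: truncnS_gt.
have m0 : 0 < m%:R :> R by rewrite ltr0n.
exists (fun k => lattice N (f (k%:R / m%:R))), m; split.
- by rewrite mul0r.
- by rewrite divff // gt_eqF.
- move=> k km; apply: lattice_king => //.
  apply: hd.
    by rewrite divr_ge0 //= ler_pdivrMr // mul1r ler_nat ltnW.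
  rewrite -mulrBl -natr1 opprD addNKr normrM normrN1 mul1r gtr0_norm ?invr_gt0 //.
  by rewrite -[d]invrK ltf_pV2 ?posrE ?invr_gt0.
- move=> k km; exists (k%:R / m%:R) => //.
  by rewrite divr_ge0 //= ler_pdivrMr // mul1r ler_nat.
Qed.

End Curves.

Lemma finite_min (R : realType) (T : finType) (P : T -> R -> Prop) :
    (forall i d d', d' <= d -> P i d -> P i d') ->
    (forall i, exists2 d, 0 < d & P i d) ->
  exists2 d, 0 < d & forall i, P i d.
Proof.
move=> mono ex.
have : forall s : seq T, exists2 d, 0 < d & forall i, i \in s -> P i d.
  elim=> [|i s [d d0 hd]]; first by exists 1.
  have [e e0 he] := ex i.
  exists (Num.min d e); first by rewrite lt_min d0.
  move=> j; rewrite inE => /orP[/eqP->|/hd].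
    by apply: mono he; rewrite ge_min lexx orbT.
  by apply: mono; rewrite ge_min lexx.
by move=> /(_ (enum T))[d d0 hd]; exists d => // i; apply: hd; rewrite mem_enum.
Qed.

Lemma lexle_antisym p q : p <> q -> lexle p q = ~~ lexle q p.
Proof.
case: p q => [a b] [c d] h; rewrite /lexle /=.
have h' : (b == d) && (a == c) = false.
  by apply/negP => /andP[/eqP e1 /eqP e2]; apply: h; rewrite e1 e2.
move: h'; lia.
Qed.

End CurveRounding.

Section DrawingCrossings.

Local Open Scope ring_scope.

Definition apart (T : eqType) (x y u v : T) : bool :=
  [&& x != u, x != v, y != u & y != v].

(* [L x y z] and [R x y z] are the parities of the crossings of the edge xy with the
   leftward and the rightward ray from z; [t] is the order of the vertices by height. *)
Definition crossing_data (G : sgraph) (L R : G -> G -> G -> bool) (t : rel G) :=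
  [/\ forall x z, x != z -> t x z = ~~ t z x,
      forall x y u v, adj x y -> adj u v -> apart x y u v ->
        L x y u (+) L x y v = R u v x (+) R u v y
    & forall x y z, adj x y -> z != x -> z != y ->
        L x y z (+) R x y z = t x z (+) t y z].

Lemma planar_crossing_data (R : realType) (G : sgraph) : planar R G ->
  exists L R t, @crossing_data G L R t.
Proof.
case=> pos [arc [posI arcP posA disj]].
(* A vertex counts as a degenerate edge with a constant curve, so that one separation statement
   covers two edges, an edge and a vertex, and two vertices. *)
pose ok (x y : G) := (x == y) || adj x y.
have curve (e : G * G) : exists f : R -> R * R, ok e.1 e.2 ->
    [/\ continuous f, f 0 = pos e.1, f 1 = pos e.2 &
        if adj e.1 e.2 then forall t, arc [set e.1; e.2]%SET (f t)
        else forall t, f t = pos e.1].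
  case: e => x y; rewrite /ok /=; case xy: (adj x y).
    by have [f [? ? ? ?]] := arc_curve (arcP _ _ xy); exists f.
  exists (fun=> pos x); rewrite orbF => /eqP <-; split => //.
  exact: cst_continuous.
have [c cP] := choice curve.
have sep (i : (G * G) * (G * G)) : exists2 d : R, 0 < d &
    ok i.1.1 i.1.2 -> ok i.2.1 i.2.2 -> apart i.1.1 i.1.2 i.2.1 i.2.2 ->
    forall s t, 0 <= s <= 1 -> 0 <= t <= 1 -> d <= `|c i.1 s - c i.2 t|.
  case: i => -[x y] [u v] /=.
  case okxy: (ok x y); last by exists 1.
  case okuv: (ok u v); last by exists 1.
  case ap: (apart x y u v); last by exists 1.
  have [cf _ _ imf] := cP (x, y) okxy; have [ch _ _ imh] := cP (u, v) okuv.
  case: (curve_sep cf ch); last by move=> d d0 hd; exists d.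
  move=> s t _ _ fh; move: ap; rewrite /apart => /and4P[/eqP xu /eqP xv /eqP yu /eqP yv].
  move: imf imh okxy okuv; rewrite /ok /=.
  case xy: (adj x y); case uv: (adj u v); rewrite ?orbT ?orbF => /(_ s) imf /(_ t) imh.
  (* A common point of two disjoint edges would be the image of a vertex, and this vertex would be
     an end of both. *)
  - move=> _ _; have ne : [set x; y]%SET != [set u; v]%SET.
      apply/eqP => /setP/(_ x); rewrite !inE eqxx /= => /esym/orP[]/eqP; [exact: xu|exact: xv].
    have [z _ hz] : range pos (c (x, y) s).
      by apply: (disj _ _ _ _ xy uv ne); split; rewrite // fh.
    rewrite -hz in imf; rewrite -fh -hz in imh.
    by case: (posA _ _ _ xy imf) (posA _ _ _ uv imh) => -> [].
  - move=> _ /eqP vE; subst v.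
    rewrite fh imh in imf; case: (posA _ _ _ xy imf) => ?; congruence.
  - move=> /eqP vE _; subst y.
    rewrite -fh imf in imh; case: (posA _ _ _ uv imh) => ?; congruence.
  - by move=> _ _; move: fh; rewrite imf imh => /posI.
have [d d0 hd] : exists2 d : R, 0 < d & forall i : (G * G) * (G * G),
    ok i.1.1 i.1.2 -> ok i.2.1 i.2.2 -> apart i.1.1 i.1.2 i.2.1 i.2.2 ->
    forall s t, 0 <= s <= 1 -> 0 <= t <= 1 -> d <= `|c i.1 s - c i.2 t|.
  apply: (finite_min (P := fun (i : (G * G) * (G * G)) d =>
    ok i.1.1 i.1.2 -> ok i.2.1 i.2.2 -> apart i.1.1 i.1.2 i.2.1 i.2.2 ->
    forall s t, 0 <= s <= 1 -> 0 <= t <= 1 -> d <= `|c i.1 s - c i.2 t|)) sep.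
  move=> i e e' le h h1 h2 h3 s t h4 h5; exact: le_trans le (h h1 h2 h3 s t h4 h5).
(* Scaling by 4 / d turns the distance d between disjoint curves into 4, which survives rounding as
   [far]. *)
pose N : R := 4 / d.
have N0 : 0 < N by rewrite divr_gt0.
have Nd : 4 / N = d by rewrite /N invf_div mulrC divfK.
have walks (e : G * G) : exists w : (nat -> int * int) * nat, ok e.1 e.2 ->
    [/\ w.1 0%N = lattice N (pos e.1), w.1 w.2 = lattice N (pos e.2),
    forall k, (k < w.2)%N -> king (w.1 k) (w.1 k.+1) &
    forall k, (k <= w.2)%N -> exists2 t, 0 <= t <= 1 & w.1 k = lattice N (c e t)].
  case oke: (ok e.1 e.2); last by exists (fun=> (0, 0), 0%N).
  have [cf f0 f1 _] := cP e oke.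
  have [w [m [h1 h2 h3 h4]]] := curve_walk cf N0.
  by exists (w, m); split; rewrite -?f0 -?f1.
have [w wP] := choice walks.
have wfar x y u v : ok x y -> ok u v -> apart x y u v ->
    forall k l, (k <= (w (x, y)).2)%N -> (l <= (w (u, v)).2)%N ->
    far ((w (x, y)).1 k) ((w (u, v)).1 l).
  move=> xy uv ap k l hk hl.
  have [_ _ _ /(_ _ hk)[s s01 ->]] := wP (x, y) xy.
  have [_ _ _ /(_ _ hl)[t t01 ->]] := wP (u, v) uv.
  by apply: lattice_far => //; rewrite Nd; apply: (hd ((x, y), (u, v))).
have okxx x : ok x x by rewrite /ok eqxx.
have okadj x y : adj x y -> ok x y by rewrite /ok => ->; rewrite orbT.
have w0 x y : ok x y -> (w (x, y)).1 0%N = lattice N (pos x) by move/(wP (x, y)) => [].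
have w1 x y : ok x y -> (w (x, y)).1 (w (x, y)).2 = lattice N (pos y).
  by move/(wP (x, y)) => [].
exists (fun x y z => walk_left (w (x, y)).1 (w (x, y)).2 (lattice N (pos z))).
exists (fun x y z => walk_right (w (x, y)).1 (w (x, y)).2 (lattice N (pos z))).
exists (fun x z => lexle (lattice N (pos x)) (lattice N (pos z))).
split.
- move=> x z xz; apply: lexle_antisym => eq.
  have ap : apart x x z z by rewrite /apart xz.
  have := wfar _ _ _ _ (okxx x) (okxx z) ap 0%N 0%N isT isT.
  by rewrite !w0 // eq /far !subrr !normr0.
- move=> x y u v /okadj xy /okadj uv ap.
  rewrite -(w0 u v) // -(w1 u v) // -(w0 x y) // -(w1 x y) //.
  apply: walk_cross.
  + by case: (wP (x, y) xy).
  + by case: (wP (u, v) uv).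
  + exact: wfar.
- move=> x y z /okadj xy zx zy; rewrite -(w0 x y) // -(w1 x y) //.
  apply: walk_winding; first by case: (wP (x, y) xy).
  move=> k hk; rewrite -(w0 z z) //; apply: wfar => //.
  by rewrite /apart ![_ == z]eq_sym zx zy.
Qed.

End DrawingCrossings.

(** * Excluding K_5 minors and K_{3,3} *)

Section ForbiddenMinors.

Section Parity.
Import Ring.

(** The next lemmas phrase the equations with [xorb], the addition of the ring of booleans in which
    [ring] computes. *)
Lemma negb_xorb a : ~~ a = xorb true a. Proof. by case: a. Qed.

Lemma xor_move a b c d : a (+) b = c (+) d -> xorb (xorb a b) (xorb c d) = false.
Proof. by case: a; case: b; case: c; case: d. Qed.

Lemma xor_solve a b c d : a (+) b = c (+) d -> b = xorb a (xorb c d).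
Proof. by case: a; case: b; case: c; case: d. Qed.

Lemma xor2 a b : a = false -> b = false -> xorb a b = false.
Proof. by move=> -> ->. Qed.

Definition pair_sum (l r : nat -> nat -> nat -> bool) i j k m :=
  xorb (xorb (l i j k) (l i j m)) (xorb (r k m i) (r k m j)).

(* Each [l i j k] occurs in exactly two of the 15 equations, so their sum involves [t]
   only, and the antisymmetry of [t] turns it into 1. *)
Lemma K5_parity (l r : nat -> nat -> nat -> bool) (t : nat -> nat -> bool) :
    (forall i k, i < 5 -> k < 5 -> i != k -> t i k = ~~ t k i) ->
    (forall i j k m, i < j < 5 -> k < m < 5 -> apart i j k m ->
      l i j k (+) l i j m = r k m i (+) r k m j) ->
    (forall i j k, i < j < 5 -> k < 5 -> k != i -> k != j ->
      l i j k (+) r i j k = t i k (+) t j k) ->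
  False.
Proof.
move=> ht hx hw.
have X i j k m : i < j < 5 -> k < m < 5 -> apart i j k m -> pair_sum l r i j k m = false.
  by move=> h1 h2 h3; apply: xor_move; apply: hx.
have W i j k : i < j < 5 -> k < 5 -> k != i -> k != j ->
    r i j k = xorb (l i j k) (xorb (t i k) (t j k)).
  by move=> *; apply: xor_solve; apply: hw.
have T i k : k < i < 5 -> t i k = xorb true (t k i).
  move=> /andP[h1 h2]; rewrite -negb_xorb; apply: ht => //; last by rewrite gtn_eqF.
  exact: ltn_trans h1 h2.
have E := xor2 (xor2 (xor2 (X 0 1 2 3 isT isT isT) (X 0 1 2 4 isT isT isT))
   (xor2 (X 0 1 3 4 isT isT isT) (X 0 2 1 3 isT isT isT)))
   (xor2 (xor2 (X 0 2 1 4 isT isT isT) (X 0 2 3 4 isT isT isT))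
   (xor2 (X 0 3 1 2 isT isT isT) (X 0 3 1 4 isT isT isT))).
have {}E := xor2 E (xor2 (xor2 (X 0 3 2 4 isT isT isT) (X 0 4 1 2 isT isT isT))
   (xor2 (X 0 4 1 3 isT isT isT) (X 0 4 2 3 isT isT isT))).
have {}E := xor2 E (xor2 (X 1 2 3 4 isT isT isT) (xor2 (X 1 3 2 4 isT isT isT)
  (X 1 4 2 3 isT isT isT))).
rewrite /pair_sum !W // in E.
rewrite (T 1 0) // (T 2 0) // (T 3 0) // (T 4 0) // (T 2 1) // (T 3 1) // in E.
rewrite (T 4 1) // (T 3 2) // (T 4 2) // (T 4 3) // in E.
suff : false = true by [].
by rewrite -[LHS]E; ring.
Qed.

(* The same computation with the parts {0, 1, 2} and {3, 4, 5} of K_{3,3}. *)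
Lemma K33_parity (l r : nat -> nat -> nat -> bool) (t : nat -> nat -> bool) :
    (forall i k, i < 6 -> k < 6 -> i != k -> t i k = ~~ t k i) ->
    (forall i j k m, i < 3 <= j -> j < 6 -> k < 3 <= m -> m < 6 -> apart i j k m ->
      l i j k (+) l i j m = r k m i (+) r k m j) ->
    (forall i j k, i < 3 <= j -> j < 6 -> k < 6 -> k != i -> k != j ->
      l i j k (+) r i j k = t i k (+) t j k) ->
  False.
Proof.
move=> ht hx hw.
have X i j k m : i < 3 <= j -> j < 6 -> k < 3 <= m -> m < 6 -> apart i j k m ->
    pair_sum l r i j k m = false.
  by move=> h1 h2 h3 h4 h5; apply: xor_move; apply: hx.
have W i j k : i < 3 <= j -> j < 6 -> k < 6 -> k != i -> k != j ->
    r i j k = xorb (l i j k) (xorb (t i k) (t j k)).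
  by move=> *; apply: xor_solve; apply: hw.
have T i k : k < i < 6 -> t i k = xorb true (t k i).
  move=> /andP[h1 h2]; rewrite -negb_xorb; apply: ht => //; last by rewrite gtn_eqF.
  exact: ltn_trans h1 h2.
(* For fixed i < k these are the six pairs of disjoint edges at i and k. The three choices of i < k
   give each of the 18 pairs of disjoint edges of K_{3,3} once. *)
have E i k : i < k < 3 -> xorb (xorb (xorb (pair_sum l r i 3 k 4) (pair_sum l r i 3 k 5))
    (xorb (pair_sum l r i 4 k 3) (pair_sum l r i 4 k 5)))
    (xorb (pair_sum l r i 5 k 3) (pair_sum l r i 5 k 4)) = false.
  by move=> ik; rewrite !X //= /apart; lia.
have {}E := xor2 (E 0 1 isT) (xor2 (E 0 2 isT) (E 1 2 isT)).
rewrite /pair_sum !W // in E.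
rewrite ?(T 1 0) ?(T 2 0) ?(T 2 1) ?(T 3 0) ?(T 3 1) ?(T 3 2) ?(T 4 0) ?(T 4 1) // in E.
rewrite ?(T 4 2) ?(T 4 3) ?(T 5 0) ?(T 5 1) ?(T 5 2) ?(T 5 3) ?(T 5 4) // in E.
suff : false = true by [].
by rewrite -[LHS]E; ring.
Qed.
End Parity.

Section PathCrossing.
Variables (G : sgraph) (L R : G -> G -> G -> bool) (t : rel G).
Hypothesis LRt : crossing_data L R t.

Fixpoint path_sum (C : G -> G -> G -> bool) x p z : bool :=
  if p is y :: q then C x y z (+) path_sum C y q z else false.

(** Crossing data extend additively from edges to vertex-disjoint paths, again by telescoping. This
    is what carries the parity argument from subgraphs to minors. *)
Lemma path_cross x p u q : path (@adj G) x p -> path (@adj G) u q ->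
    (forall a b, a \in x :: p -> b \in u :: q -> a != b) ->
  path_sum L x p u (+) path_sum L x p (last u q) =
  path_sum R u q x (+) path_sum R u q (last x p).
Proof.
have [_ cross _] := LRt.
have edge a b : adj a b -> forall v s, path (@adj G) v s ->
    (forall c, c \in v :: s -> (a != c) && (b != c)) ->
    L a b v (+) L a b (last v s) = path_sum R v s a (+) path_sum R v s b.
  move=> ab v s; elim: s v => [|w s IH] v /=; first by rewrite !addbb.
  move=> /andP[vw ws] dis.
  have := IH w ws (fun c hc => dis c (mem_behead (s := v :: w :: s) hc)).
  have ap : apart a b v w.
    have := dis v; have := dis w; rewrite !inE !eqxx ?orbT /apart.
    by move=> /(_ isT)/andP[-> ->] /(_ isT)/andP[-> ->].
  have := cross _ _ _ _ ab vw ap.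
  move: (L _ _ _) (L _ _ _) (L _ _ _) => b1 b2 b3.
  move: (R _ _ _) (R _ _ _) => b4 b5.
  move: (path_sum _ _ _ _) (path_sum _ _ _ _) => b6 b7.
  by case: b1; case: b2; case: b3; case: b4; case: b5; case: b6; case: b7.
move=> + uq; elim: p x => [|y p IH] x /=; first by rewrite addbb.
move=> /andP[xy yp] dis.
have := IH y yp (fun a b ha => dis a b (mem_behead (s := x :: y :: p) ha)).
have : L x y u (+) L x y (last u q) = path_sum R u q x (+) path_sum R u q y.
  by apply: edge => // c hc; rewrite !dis ?inE ?eqxx ?orbT.
move: (L _ _ _) (L _ _ _) => b1 b2.
move: (path_sum _ _ _ _) (path_sum _ _ _ _) (path_sum _ _ _ _) => b3 b4 b5.
move: (path_sum _ _ _ _) (path_sum _ _ _ _) => b6 b7.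
by case: b1; case: b2; case: b3; case: b4; case: b5; case: b6; case: b7.
Qed.

Lemma path_winding x p z : path (@adj G) x p -> z \notin x :: p ->
  path_sum L x p z (+) path_sum R x p z = t x z (+) t (last x p) z.
Proof.
have [_ _ wind] := LRt.
elim: p x => [|y p IH] x /=; first by rewrite addbb.
move=> /andP[xy yp]; rewrite inE negb_or => /andP[zx zy].
have := IH y yp zy.
have zy' : z != y by move: zy; rewrite inE negb_or => /andP[].
have := wind _ _ _ xy zx zy'.
move: (L _ _ _) (R _ _ _) (path_sum _ _ _ _) (path_sum _ _ _ _) => b1 b2 b3 b4.
move: (t _ _) (t _ _) (t _ _) => b5 b6 b7.
by case: b1; case: b2; case: b3; case: b4; case: b5; case: b6; case: b7.
Qed.

End PathCrossing.

Section Minors.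
Variable G : sgraph.
Implicit Types (A B U S : {set G}) (x y z u v : G).

(** Growth by one neighbour at a time matches how such sets arise: the set enlarged in
    [clique_minor_step] and the vertex set of a path in [connected_seq]. *)
Inductive connected_set : {set G} -> Prop :=
| connected_single x : connected_set [set x]
| connected_add U u v : connected_set U -> u \in U -> adj u v -> connected_set (v |: U).

Lemma connected_path U : connected_set U -> forall x y, x \in U -> y \in U ->
  exists p, [/\ path (@adj G) x p, last x p = y & {subset p <= U}].
Proof.
elim=> {U} [z|U u v _ IH uU uv] x y.
  by rewrite !inE => /eqP-> /eqP->; exists [::].
rewrite !inE => /orP[/eqP->|xU] /orP[/eqP->|yU].
- by exists [::].
- have [p [pp pl pU]] := IH u y uU yU; exists (u :: p); split => //=.
    by rewrite adj_sym uv.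
  by move=> a; rewrite !inE => /orP[/eqP->|/pU->]; rewrite ?uU orbT.
- have [p [pp pl pU]] := IH x u xU uU; exists (rcons p v); split.
  + by rewrite rcons_path pp pl.
  + by rewrite last_rcons.
  + by move=> a; rewrite mem_rcons !inE => /orP[->//|/pU->]; rewrite orbT.
- have [p [pp pl pU]] := IH x y xU yU; exists p; split => //.
  by move=> a /pU; rewrite !inE => ->; rewrite orbT.
Qed.

Definition touch A B : bool :=
  [disjoint A & B] && [exists x in A, [exists y in B, adj x y]].

(* The branch sets of a minor isomorphic to the complete graph on [size s] vertices. *)
Definition clique_minor (s : seq {set G}) : Prop :=
  (forall A, A \in s -> connected_set A) /\ pairwise touch s.

Lemma connected_nonempty U : connected_set U -> exists x, x \in U.
Proof. by case=> [x|U' u v _ _ _]; [exists x|exists v]; rewrite !inE eqxx. Qed.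

Lemma touch_path A B : connected_set A -> connected_set B -> touch A B ->
  forall x y, x \in A -> y \in B ->
  exists p, [/\ path (@adj G) x p, last x p = y & {subset x :: p <= A :|: B}].
Proof.
move=> cA cB /andP[_ /existsP[a /andP[aA /existsP[b /andP[bB ab]]]]] x y xA yB.
have [p [pp pl pU]] := connected_path cA xA aA.
have [q [qp ql qU]] := connected_path cB bB yB.
exists (p ++ b :: q); split.
- by rewrite cat_path pp /= pl ab.
- by rewrite last_cat.
- move=> c; rewrite !inE mem_cat inE => /or4P[/eqP->|/pU->|/eqP->|/qU->] //;
  by rewrite ?xA ?bB ?orbT.
Qed.

Variables (L R : G -> G -> G -> bool) (t : rel G).
Hypothesis LRt : crossing_data L R t.

(** One vertex is chosen in each branch set, and the path joining those of B i and B j stays in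
    their union. So disjoint pairs of indices have disjoint paths, and the path sums satisfy the
    equations of K_5. *)
Lemma no_K5_minor s : clique_minor s -> size s = 5 -> False.
Proof.
case=> conn /(pairwiseP finset.set0) touching sz.
pose B i := nth finset.set0 s i.
have cB i : i < 5 -> connected_set (B i) by move=> i5; apply: conn; rewrite mem_nth ?sz.
have tB i j : i < j < 5 -> touch (B i) (B j).
  by move=> /andP[ij j5]; apply: touching; rewrite ?inE ?sz // (ltn_trans ij).
have /choice[v vB] i : exists x, i < 5 -> x \in B i.
  case i5: (i < 5); first by have [x xB] := connected_nonempty (cB i i5); exists x.
  have [x _] := connected_nonempty (cB 0 isT); by exists x.
have /choice[p pP] (e : nat * nat) : exists p, e.1 < e.2 < 5 -> [/\ path (@adj G) (v e.1) p,
     last (v e.1) p = v e.2 & {subset v e.1 :: p <= B e.1 :|: B e.2}].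
  case: e => i j /=; case ij: (i < j < 5); last by exists [::].
  have /andP[h1 h2] := ij; have h3 := ltn_trans h1 h2.
  have [q hq] := touch_path (cB i h3) (cB j h2) (tB i j ij) (vB i h3) (vB j h2).
  by exists q.
have disj i k a b : i < 5 -> k < 5 -> i != k -> a \in B i -> b \in B k -> a != b.
  move=> i5 k5 ne; wlog ik : i k a b i5 k5 ne / i < k.
    move=> W ai bk; have := ne; rewrite neq_ltn => /orP[ik|ki]; first exact: (W i k).
    by rewrite eq_sym; apply: (W k i) => //; rewrite eq_sym.
  have := tB i k; rewrite ik k5 => /(_ isT)/andP[/disjointFr dis _] ai bk.
  by apply/eqP => ab; have := dis _ ai; rewrite ab bk.
have [anti _ _] := LRt.
apply: (@K5_parity (fun i j k => path_sum L (v i) (p (i, j)) (v k))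
   (fun i j k => path_sum R (v i) (p (i, j)) (v k)) (fun i k => t (v i) (v k))).
- by move=> i k i5 k5 ne; apply: anti; apply: (disj i k); rewrite ?vB.
- move=> i j k m ij km /and4P[ik im jk jm].
  have [h1 h2 h3] := pP (i, j) ij; have [h4 h5 h6] := pP (k, m) km.
  rewrite /= in h1 h2 h3 h4 h5 h6.
  rewrite -h5 -h2; apply: (path_cross LRt) => // a b /h3 + /h6.
  move/andP: ij => [ij j5]; move/andP: km => [km m5].
  have i5 := ltn_trans ij j5; have k5 := ltn_trans km m5.
  rewrite !inE => /orP[aB|aB] /orP[bB|bB]; exact: disj aB bB.
- move=> i j k ij k5 ki kj.
  have [h1 h2 h3] := pP (i, j) ij; rewrite /= in h1 h2 h3.
  rewrite -h2; apply: (path_winding LRt) => //.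
  apply/negP => /h3; move/andP: ij => [ij j5]; have i5 := ltn_trans ij j5.
  rewrite !inE => /orP[aB|aB].
    by have := disj k i _ _ k5 i5 ki (vB k k5) aB; rewrite eqxx.
  by have := disj k j _ _ k5 j5 kj (vB k k5) aB; rewrite eqxx.
Qed.

Lemma no_K33 (s : seq G) : uniq s -> size s = 6 ->
  (forall i j x, i < 3 <= j -> j < 6 -> adj (nth x s i) (nth x s j)) -> False.
Proof.
move=> us sz adjs; case: s us sz adjs => // x0 s us sz adjs.
pose v i := nth x0 (x0 :: s) i.
have dist i k : i < 6 -> k < 6 -> i != k -> v i != v k.
  by move=> i6 k6 ne; rewrite nth_uniq // sz.
have [anti cross wind] := LRt.
apply: (@K33_parity (fun i j k => L (v i) (v j) (v k))
   (fun i j k => R (v i) (v j) (v k)) (fun i k => t (v i) (v k))).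
- by move=> i k i6 k6 ne; apply: anti; apply: dist.
- move=> i j k m ij j6 km m6 /and4P[ik im jk jm].
  have [/andP[i3 _] /andP[k3 _]] := (ij, km).
  have [i6 k6] : i < 6 /\ k < 6 by split; [exact: ltn_trans i3 _|exact: ltn_trans k3 _].
  by apply: cross; rewrite ?adjs // /apart !dist.
- move=> i j k ij j6 k6 ki kj.
  have /andP[i3 _] := ij; have i6 : i < 6 by exact: ltn_trans i3 _.
  by apply: wind; rewrite ?adjs ?dist.
Qed.

End Minors.

End ForbiddenMinors.

(** * Degeneracy of planar graphs *)

Section Sparsity.

Section Degeneracy.
Variable G : sgraph.
Implicit Types (A B U S W : {set G}) (x y z u v : G).

Definition nbrs S x : {set G} := [set y in S | adj x y].
Definition deg S x : nat := #|nbrs S x|.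
Definition degsum S : nat := \sum_(x in S) deg S x.

Lemma deg_sum S x : deg S x = \sum_(y in S) adj x y.
Proof.
rewrite /deg -sum1_card big_mkcond [RHS]big_mkcond; apply: eq_bigr => y _.
by rewrite inE; case: (y \in S); case: (adj x y).
Qed.

Lemma deg_remove S x v : v \in S -> deg S x = adj x v + deg (S :\ v) x.
Proof. by move=> vS; rewrite !deg_sum (big_setD1 v vS). Qed.

Lemma deg_remove_self S v : deg (S :\ v) v = deg S v.
Proof.
apply: eq_card => y; rewrite !inE; case: (y =P v) => //= ->.
by rewrite adj_irrefl andbF.
Qed.

Lemma degsum_remove S v : v \in S -> degsum S = degsum (S :\ v) + (deg S v).*2.
Proof.
move=> vS; rewrite /degsum (big_setD1 v vS) /=.
rewrite (eq_bigr (fun x => adj x v + deg (S :\ v) x)); last first.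
  by move=> x _; exact: deg_remove.
rewrite big_split /=.
have -> : \sum_(x in S :\ v) adj x v = deg S v.
  by rewrite -deg_remove_self deg_sum; apply: eq_bigr => x _; rewrite adj_sym.
by rewrite addnA -addnn addnC.
Qed.

Definition boundary S U : {set G} := [set v in S :\: U | [exists u in U, adj u v]].

(** v leaves the boundary, while its neighbours in S outside U that were not yet in the boundary
    enter it. *)
Lemma boundary_add S U v : v \in boundary S U ->
  #|boundary S (v |: U)| + deg (boundary S U) v + 1 = #|boundary S U| + deg (S :\: U) v.
Proof.
move=> vN; have := vN; rewrite inE => /andP[vSU _].
set W := S :\: U; set N := boundary S U.
have NW : N \subset W by apply/fintype.subsetP => a; rewrite inE => /andP[].
have -> : boundary S (v |: U) = (N :\ v) :|: nbrs (W :\: N) v.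
  apply/setP => a; rewrite !inE.
  have E : [exists u in v |: U, adj u a] = adj v a || [exists u in U, adj u a].
    apply/existsP/orP => [[u /andP[]]|[va|/existsP[u /andP[uU ua]]]].
    - by rewrite !inE => /orP[/eqP->|uU ua]; [left|right; apply/existsP; exists u; rewrite uU].
    - by exists v; rewrite !inE eqxx.
    - by exists u; rewrite !inE uU orbT.
  rewrite E; case: (a =P v) => [->|_] /=; last first.
    by case: (a \in U); case: (a \in S); case: (adj v a); case: [exists u in U, adj u a].
  by rewrite adj_irrefl !andbF.
have -> : deg W v = deg N v + deg (W :\: N) v.
  by rewrite deg_sum (big_setID N) /= (finset.setIidPr NW) !deg_sum.
rewrite cardsU (cardsD1 v N) vN.
have -> : (N :\ v) :&: nbrs (W :\: N) v = finset.set0.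
  apply/setP => a; rewrite !inE; case: (a \in S); case: (a \in U) => //=; rewrite ?andbF //.
  by case: [exists u in U, adj u a]; rewrite ?andbF.
rewrite cards0 subn0 /deg; lia.
Qed.

(* Mader: take a maximal connected U whose contraction leaves average degree at least
   4 C.  Moving a vertex v of the boundary of U into U loses 1 + deg v edges, where the
   degree is taken in the boundary; so by maximality the boundary has minimum degree at
   least 2 C, and U completes any clique minor found in the boundary. *)
Lemma clique_minor_step r C : 0 < C ->
    (forall S, S != finset.set0 -> 2 * C * #|S| <= degsum S ->
      exists s, [/\ clique_minor s, size s = r & forall A, A \in s -> A \subset S]) ->
  forall S, S != finset.set0 -> 4 * C * #|S| <= degsum S ->
    exists s, [/\ clique_minor s, size s = r.+1 & forall A, A \in s -> A \subset S].
Proof.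
move=> C0 IHr S; have [n] := ubnP #|S|; elim: n S => // n IHn S Sn S0 dS.
(* Contracting U leaves #|S| - #|U| + 1 vertices, and the right-hand side is the degree sum of the
   contraction, where each boundary vertex sends one edge to the contracted one. Induction on k, a
   bound on the number of vertices outside U, replaces the choice of a maximal U. *)
have grow : forall k U, #|S| - #|U| <= k -> U \subset S -> connected_set U ->
    4 * C * (#|S| - #|U| + 1) <= degsum (S :\: U) + 2 * #|boundary S U| ->
    exists s, [/\ clique_minor s, size s = r.+1 & forall A, A \in s -> A \subset S].
  elim=> [|k IHk] U kU US cU hU.
    have SU : S :\: U = finset.set0.
      by apply/eqP; rewrite -cards_eq0 cardsD (finset.setIidPr US) -leqn0.
    move: hU; rewrite /degsum SU big_set0.
    have -> : boundary S U = finset.set0 by apply/setP => a; rewrite inE SU !inE.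
    rewrite cards0; lia.
  have cardSU : #|S :\: U| = #|S| - #|U| by rewrite cardsD (finset.setIidPr US).
  (* With an empty boundary, S :\: U satisfies the degree hypothesis by itself and is smaller than
     S. *)
  have [N0|N0] := eqVneq (boundary S U) finset.set0.
    move: hU; rewrite N0 cards0 -cardSU => hU.
    have [z zU] := connected_nonempty cU.
    have SU0 : S :\: U != finset.set0.
      by apply/eqP => SU0; move: hU; rewrite SU0 /degsum big_set0 cards0; lia.
    case: (IHn (S :\: U)) => //.
    - have : 0 < #|U| by apply/card_gt0P; exists z.
      have := subset_leq_card US; lia.
    - lia.
    - move=> s [cs ss sS]; exists s; split => // A /sS h.
      by apply: fintype.subset_trans h (subsetDl _ _).
  have [/forall_inP big|/forall_inPn[v vN]] :=
      boolP [forall v in boundary S U, 2 * C <= deg (boundary S U) v].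
    case: (IHr _ N0).
      by rewrite mulnC -sum_nat_const; apply: leq_sum => v /big.
    move=> s [[cs ps] ss sN]; exists (U :: s); split => /=.
    - split=> [A|/=]; first by rewrite inE => /orP[/eqP->|/cs].
      rewrite ps andbT; apply/allP => A As; apply/andP; split.
        rewrite finset.disjoints_subset; apply/fintype.subsetP => a aU; rewrite inE.
        apply/negP => /(fintype.subsetP (sN A As)); rewrite !inE aU //.
      have [a aA] := connected_nonempty (cs A As).
      have := fintype.subsetP (sN A As) a aA; rewrite inE => /andP[_ /existsP[u /andP[uU ua]]].
      apply/existsP; exists u; rewrite uU; apply/existsP; exists a; by rewrite aA.
    - by rewrite ss.
    - move=> A; rewrite inE => /orP[/eqP->//|/sN h].
      apply: fintype.subset_trans h _; apply/fintype.subsetP => a.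
      by rewrite !inE => /andP[/andP[]].
  rewrite -ltnNge => dv.
  have := vN; rewrite !inE => /andP[/andP[vU vS] /existsP[u /andP[uU uv]]].
  have vW : v \in S :\: U by rewrite !inE vU.
  have eW : S :\: (v |: U) = (S :\: U) :\ v by apply/setP => a; rewrite !inE negb_or andbA.
  have hc : #|v |: U| = #|U| + 1 by rewrite cardsU1 vU addnC.
  have le : #|v |: U| <= #|S|.
    by apply: subset_leq_card; rewrite finset.subUset finset.sub1set vS.
  apply: (IHk (v |: U)).
  - rewrite hc; move: kU; lia.
  - by rewrite finset.subUset finset.sub1set vS.
  - exact: (connected_add cU uU uv).
  - have := boundary_add vN; have := degsum_remove vW; rewrite eW hc.
    rewrite hc in le; move: hU dv; rewrite -!muln2.
    have -> : #|S| - #|U| = (#|S| - (#|U| + 1)) + 1 by lia.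
    move: (#|S| - _) => m; rewrite !mulnDr; lia.
have [x xS] := set0Pn _ S0.
(* For a single vertex the contraction is S itself. *)
apply: (grow #|S| [set x]).
- exact: leq_subr.
- by rewrite finset.sub1set.
- exact: connected_single.
- rewrite cards1; have S1 : 0 < #|S| by apply/card_gt0P; exists x.
  have -> : #|boundary S [set x]| = deg S x.
    apply: eq_card => a; rewrite !inE; case: (a =P x) => [->|_] /=.
      by rewrite adj_irrefl andbF.
    congr andb; apply/existsP/idP => [[u /andP[]]|xa]; first by rewrite inE => /eqP->.
    by exists x; rewrite inE eqxx.
  by have := degsum_remove xS; rewrite -muln2 subnK // => e; rewrite mulnC -mulnC; lia.
Qed.

Lemma clique_minor2 S : S != finset.set0 -> 2 * 1 * #|S| <= degsum S ->
  exists s, [/\ clique_minor s, size s = 2 & forall A, A \in s -> A \subset S].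
Proof.
move=> S0 dS.
have [x xS dx] : exists2 x, x \in S & 0 < deg S x.
  apply/exists_inP; apply: contraT => /exists_inPn h.
  have : degsum S = 0 by apply: big1 => x /h; rewrite -eqn0Ngt => /eqP.
  by move=> e; move: dS; rewrite e; have := card_gt0 S; rewrite S0; lia.
have := dx; rewrite /deg => /card_gt0P[y]; rewrite inE => /andP[yS xy].
exists [:: [set x]; [set y]]; split => //; first split => [A|/=].
- by rewrite !inE => /orP[]/eqP->; exact: connected_single.
- rewrite !andbT /touch; apply/andP; split.
    by rewrite disjoints1 inE; apply/eqP => e; move: xy; rewrite e adj_irrefl.
  by apply/existsP; exists x; rewrite inE eqxx; apply/existsP; exists y; rewrite inE eqxx.
- by move=> A; rewrite !inE => /orP[]/eqP->; rewrite finset.sub1set.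
Qed.

Lemma degenerate (L R : G -> G -> G -> bool) (t : rel G) : crossing_data L R t ->
  forall S, S != finset.set0 -> exists2 x, x \in S & deg S x <= 15.
Proof.
move=> LRt S S0; apply/exists_inP; apply: contraT => /exists_inPn h.
have dS : 4 * 4 * #|S| <= degsum S.
  by rewrite mulnC -sum_nat_const; apply: leq_sum => x /h; rewrite -ltnNge.
(* The required average degree is 2 for one edge and doubles with each further branch set: 4, 8 and
   finally 16 for K_5, whence the bound 15. *)
have H3 := @clique_minor_step 2 1 isT clique_minor2.
have H4 := @clique_minor_step 3 2 isT H3.
have H5 := @clique_minor_step 4 4 isT H4.
by have [s [cs ss _]] := H5 S S0 dS; case: (no_K5_minor LRt cs ss).
Qed.

End Degeneracy.

End Sparsity.

(** * Quadratic forms of adjacency matrices *)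

Section QuadraticForms.

Local Open Scope ring_scope.

Section Forms.
Variables (R : realFieldType) (G : sgraph) (z : G -> R).
Implicit Types (S T : {set G}) (x y v : G).

Definition adjr x y : R := (adj x y)%:R.
(** This is the entry at x of A applied to the restriction of z to S. Hence [qform S T] is the
    bilinear form of A at the restrictions of z to S and T, and [qform S S] counts every edge
    twice. *)
Definition nsum S x : R := \sum_(y in S) adjr x y * z y.
Definition qform S T : R := \sum_(x in S) z x * nsum T x.
Definition sqsum S : R := \sum_(x in S) z x ^+ 2.

Lemma adjrC x y : adjr x y = adjr y x. Proof. by rewrite /adjr adj_sym. Qed.

Lemma nsum_nbrs S x : nsum S x = \sum_(y in nbrs S x) z y.
Proof.
rewrite /nsum big_mkcond [RHS]big_mkcond; apply: eq_bigr => y _.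
by rewrite inE /adjr; case: (y \in S); case: (adj x y); rewrite /= ?mul1r ?mul0r.
Qed.

Lemma qformC S T : qform S T = qform T S.
Proof.
rewrite /qform /nsum; under eq_bigr do rewrite mulr_sumr.
rewrite exchange_big /=; apply: eq_bigr => y _; rewrite mulr_sumr.
by apply: eq_bigr => x _; rewrite adjrC; ring.
Qed.

Lemma amgm (a b e : R) : 0 < e -> 2 * (a * b) <= e * a ^+ 2 + b ^+ 2 / e.
Proof.
move=> e0; have h : 0 <= e^-1 * (e * a - b) ^+ 2.
  by apply: mulr_ge0; [rewrite invr_ge0 ltW|exact: sqr_ge0].
have : e^-1 * (e * a - b) ^+ 2 = e * a ^+ 2 + b ^+ 2 / e - 2 * (a * b).
  by field; rewrite gt_eqF.
by move=> E; rewrite E in h; lra.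
Qed.

Lemma sqr_sum_le S (f : G -> R) :
  (\sum_(x in S) f x) ^+ 2 <= #|S|%:R * \sum_(x in S) f x ^+ 2.
Proof.
have h : forall x y, 2 * (f x * f y) <= f x ^+ 2 + f y ^+ 2.
  by move=> x y; have := amgm (f x) (f y) (ltr01 : 0 < 1 :> R); rewrite mul1r divr1.
suff : 2 * (\sum_(x in S) f x) ^+ 2 <= 2 * (#|S|%:R * \sum_(x in S) f x ^+ 2).
  by rewrite ler_pM2l.
rewrite expr2 mulr_suml mulr_sumr.
apply: (@le_trans _ _ (\sum_(x in S) \sum_(y in S) (f x ^+ 2 + f y ^+ 2))).
  apply: ler_sum => x _; rewrite !mulr_sumr; apply: ler_sum => y _; exact: h.
under eq_bigr do rewrite big_split sumr_const /=.
rewrite big_split sumr_const /= sumrMnl -mulrnDl.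
by rewrite mulrCA (mulr_natl _ #|S|) (mulr_natl _ 2) mulr2n.
Qed.

Lemma deg_natr S x : (deg S x)%:R = \sum_(y in S) adjr x y.
Proof. by rewrite deg_sum natr_sum. Qed.

(** The Laplacian of the graph induced on S is positive semidefinite. *)
Lemma qform_deg_le S : qform S S <= \sum_(x in S) (deg S x)%:R * z x ^+ 2.
Proof.
suff : 2 * qform S S <= 2 * \sum_(x in S) (deg S x)%:R * z x ^+ 2 by rewrite ler_pM2l.
have -> : 2 * \sum_(x in S) (deg S x)%:R * z x ^+ 2 =
    \sum_(x in S) \sum_(y in S) adjr x y * (z x ^+ 2 + z y ^+ 2).
  under [RHS]eq_bigr do under eq_bigr do rewrite mulrDr.
  under [RHS]eq_bigr do rewrite big_split /=.
  rewrite big_split /= [X in _ = _ + X]exchange_big /=.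
  under [X in _ = X + _]eq_bigr do rewrite -mulr_suml -deg_natr.
  under [X in _ = _ + X]eq_bigr do
    [rewrite -mulr_suml; under eq_bigr do rewrite adjrC; rewrite -deg_natr].
  by rewrite mulr_natl mulr2n.
rewrite /qform mulr_sumr; apply: ler_sum => x _.
rewrite /nsum !mulr_sumr; apply: ler_sum => y _.
have := amgm (z x) (z y) (ltr01 : 0 < 1 :> R); rewrite mul1r divr1.
have : 0 <= adjr x y by exact: ler0n.
by move=> a0 h; have := ler_wpM2l a0 h; rewrite [z x * (_ * _)]mulrCA [2 * (adjr _ _ * _)]mulrCA.
Qed.

Lemma qform_remove S v : v \in S ->
  qform S S = qform (S :\ v) (S :\ v) + 2 * \sum_(y in nbrs S v) z v * z y.
Proof.
move=> vS.
have split T x : nsum T x = (v \in T)%:R * (adjr x v * z v) + nsum (T :\ v) x.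
  case vT: (v \in T); first by rewrite /nsum (big_setD1 v vT) /= mul1r.
  by rewrite mul0r add0r /nsum; apply: eq_bigl => y; rewrite !inE; case: eqP => [->|].
rewrite {1}/qform (big_setD1 v vS) /=.
rewrite (eq_bigr (fun x => z x * (adjr x v * z v) + z x * nsum (S :\ v) x)); last first.
  by move=> x _; rewrite split vS mul1r mulrDr.
rewrite big_split /= -/(qform _ _).
have -> : \sum_(x in S :\ v) z x * (adjr x v * z v) = z v * nsum (S :\ v) v.
  by rewrite /nsum mulr_sumr; apply: eq_bigr => x _; rewrite adjrC; ring.
have -> : nsum S v = nsum (S :\ v) v by rewrite split /adjr adj_irrefl /= mul0r mulr0 add0r.
rewrite -mulr_sumr.
have -> : \sum_(y in nbrs S v) z y = nsum (S :\ v) v.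
  by rewrite -nsum_nbrs split /adjr adj_irrefl /= mul0r mulr0 add0r.
ring.
Qed.

(* Orient each edge out of the vertex removed first, and apply [amgm] to it. *)
Lemma qform_degenerate_le k (a : R) : 0 < a ->
    (forall S, S != finset.set0 -> exists2 x, x \in S & (deg S x <= k)%N) ->
  forall S, qform S S <= \sum_(x in S) (k%:R * a + (deg S x)%:R / a) * z x ^+ 2.
Proof.
move=> a0 hk S; have [n] := ubnP #|S|; elim: n S => // n IH S Sn.
have [->|S0] := eqVneq S finset.set0; first by rewrite /qform !big_set0.
have [v vS dv] := hk S S0.
have cS : (#|S :\ v| < n)%N by move: Sn; rewrite (cardsD1 v S) vS.
rewrite (qform_remove vS) (big_setD1 v vS) /=.
have -> : \sum_(x in S :\ v) (k%:R * a + (deg S x)%:R / a) * z x ^+ 2 =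
   \sum_(x in S :\ v) (k%:R * a + (deg (S :\ v) x)%:R / a) * z x ^+ 2 +
   \sum_(y in nbrs S v) z y ^+ 2 / a.
  have -> : \sum_(y in nbrs S v) z y ^+ 2 / a = \sum_(x in S :\ v) adjr v x * (z x ^+ 2 / a).
    rewrite big_mkcond [RHS]big_mkcond; apply: eq_bigr => y _.
    rewrite !inE /adjr; case: (y =P v) => [->|_] /=; first by rewrite adj_irrefl andbF.
    by case: (y \in S); case: (adj v y); rewrite ?mul1r ?mul0r.
  rewrite -big_split /=; apply: eq_bigr => x xS.
  by rewrite (deg_remove x vS) natrD -/(adjr x v) adjrC; field; rewrite gt_eqF.
have h1 := IH _ cS.
have h2 : 2 * \sum_(y in nbrs S v) z v * z y <=
   (deg S v)%:R * (a * z v ^+ 2) + \sum_(y in nbrs S v) z y ^+ 2 / a.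
  rewrite mulr_sumr mulr_natl -sumr_const -big_split /=.
  by apply: ler_sum => y _; exact: amgm.
have h3 : (deg S v)%:R * (a * z v ^+ 2) <= k%:R * (a * z v ^+ 2).
  by apply: ler_wpM2r; [rewrite mulr_ge0 ?sqr_ge0 ?ltW|rewrite ler_nat].
have h4 : 0 <= (deg S v)%:R / a * z v ^+ 2.
  by rewrite mulr_ge0 ?sqr_ge0 // divr_ge0 // ltW.
have -> : (k%:R * a + (deg S v)%:R / a) * z v ^+ 2 =
    k%:R * (a * z v ^+ 2) + (deg S v)%:R / a * z v ^+ 2 by ring.
lra.
Qed.

End Forms.

Lemma degsum_le (G : sgraph) k :
    (forall S : {set G}, S != finset.set0 -> exists2 x, x \in S & (deg S x <= k)%N) ->
  forall S : {set G}, (degsum S <= k.*2 * #|S|)%N.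
Proof.
move=> hk S; have [n] := ubnP #|S|; elim: n S => // n IH S Sn.
have [->|S0] := eqVneq S finset.set0; first by rewrite /degsum big_set0.
have [v vS dv] := hk S S0.
have cS : (#|S :\ v| < n)%N by move: Sn; rewrite (cardsD1 v S) vS.
have := IH _ cS; rewrite (degsum_remove vS) (cardsD1 v S) vS mulnDr muln1 addnC.
by move=> h; apply: leq_add => //; rewrite leq_double.
Qed.

End QuadraticForms.

(** * Two vertices of almost full degree *)

Section TwoHubs.

Local Open Scope ring_scope.

Definition common (G : sgraph) (a b c : G) : {set G} :=
  [set y | [&& adj a y, adj b y & adj c y]].

Definition K33_free (G : sgraph) := forall a b c : G,
  a != b -> a != c -> b != c -> (#|common a b c| <= 2)%N.

Definition degenerate_by (k : nat) (G : sgraph) := forall S : {set G},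
  S != finset.set0 -> exists2 x, x \in S & (deg S x <= k)%N.

Lemma card_bigcup_le (I T : finType) (P : pred I) (F : I -> {set T}) :
  (#|\bigcup_(i | P i) F i| <= \sum_(i | P i) #|F i|)%N.
Proof.
elim/big_ind2: _ => [|m A n B hA hB|//]; first by rewrite cards0.
by rewrite (leq_trans (leq_card_setU _ _)) // leq_add.
Qed.

Section Hubs.
Variables (R : realFieldType) (G : sgraph) (z : G -> R).
Implicit Types (S T L : {set G}) (x y : G).

Lemma qform_setCr S L : qform z S [set: G] = qform z S L + qform z S (~: L).
Proof.
rewrite /qform -big_split /=; apply: eq_bigr => x _; rewrite -mulrDr; congr (_ * _).
by rewrite /nsum (big_setID L) /= finset.setTI finset.setTD.
Qed.

Lemma qform_setCl S L : qform z [set: G] S = qform z L S + qform z (~: L) S.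
Proof. by rewrite qformC (qform_setCr S L) ![qform z S _]qformC. Qed.

Lemma qform_ge (lam : R) : (forall x, 0 <= z x) ->
    (forall x, lam * z x <= nsum z [set: G] x) ->
  lam * sqsum z [set: G] <= qform z [set: G] [set: G].
Proof.
move=> z0 hz; rewrite /sqsum mulr_sumr; apply: ler_sum => x _.
have := ler_wpM2l (z0 x) (hz x); rewrite mulrCA expr2; exact.
Qed.

Lemma sqsum_ge0 S : 0 <= sqsum z S.
Proof. by apply: sumr_ge0 => x _; exact: sqr_ge0. Qed.

Lemma sqsum_eq0 S : sqsum z S <= 0 -> forall x, x \in S -> z x = 0.
Proof.
move=> h x xS; apply/eqP; rewrite -sqrf_eq0; apply/eqP/le_anti.
rewrite sqr_ge0 andbT; apply: le_trans h; rewrite /sqsum (big_setD1 x xS) /= lerDl.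
by apply: sumr_ge0 => y _; exact: sqr_ge0.
Qed.

Lemma sqsum_sub S T : S \subset T -> sqsum z S <= sqsum z T.
Proof.
move=> ST; rewrite /sqsum [leRHS](big_setID S) /= (finset.setIidPr ST) lerDl.
by apply: sumr_ge0 => y _; exact: sqr_ge0.
Qed.

Lemma nsum_sqr_le S x : nsum z S x ^+ 2 <= (deg S x)%:R * sqsum z S.
Proof.
rewrite nsum_nbrs; apply: le_trans (sqr_sum_le _ _) _.
apply: ler_wpM2l => //; apply: sqsum_sub; by apply/fintype.subsetP => y; rewrite inE => /andP[].
Qed.

Lemma qform_card_le S : qform z S S <= #|S|%:R * sqsum z S.
Proof.
apply: le_trans (qform_deg_le _ _) _; rewrite /sqsum mulr_sumr; apply: ler_sum => x xS.
apply: ler_wpM2r; first exact: sqr_ge0.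
by rewrite ler_nat; apply: subset_leq_card; apply/fintype.subsetP => y; rewrite inE => /andP[].
Qed.

(** Each of these vertices is a common neighbour of three distinct vertices of L, and a triple has
    at most two common neighbours. *)
Lemma card_many_nbrs L : K33_free G -> (#|[set r | 2 < deg L r]%N| <= 2 * #|L| ^ 3)%N.
Proof.
move=> k33.
pose F (t : G * G * G) := if [&& t.1.1 != t.1.2, t.1.1 != t.2 & t.1.2 != t.2]
  then common t.1.1 t.1.2 t.2 else finset.set0.
pose X := finset.setX (finset.setX L L) L.
have sub : [set r | 2 < deg L r]%N \subset \bigcup_(t in X) F t.
  apply/fintype.subsetP => r; rewrite inE /deg => /card_gt2P[a [b [c [[aL bL cL] [ab bc ca]]]]].
  move: aL bL cL; rewrite !inE => /andP[aL ra] /andP[bL rb] /andP[cL rc].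
  apply/bigcupP; exists (a, b, c); first by rewrite !inE aL bL cL.
  rewrite /F /= ab bc [a == c]eq_sym ca /= !inE.
  by rewrite ![adj _ r]adj_sym ra rb rc.
apply: leq_trans (subset_leq_card sub) _; apply: leq_trans (card_bigcup_le _ _) _.
apply: leq_trans (_ : \sum_(t in X) 2 <= _)%N.
  apply: leq_sum => -[[a b] c] _; rewrite /F /=.
  by case: ifP => [/and3P[]|_]; [exact: k33|rewrite cards0].
by rewrite sum_nat_const !cardsX mulnC leq_mul2l !expnS expn0 muln1 mulnA leqnn.
Qed.

Variables (lam eps c eta kap : R).

Lemma two_hubs :
    0 < eps -> 0 < c -> 15 * c + eps / c <= eta -> 24 * eta <= kap -> kap < 1 / 4 ->
    2 <= lam -> 30 / eps <= eta * lam -> 2 * (30 / eps) ^+ 4 <= eta * lam ^+ 2 ->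
    2 * #|G|%:R <= lam ^+ 2 ->
    K33_free G -> degenerate_by 15 G ->
    (forall x, 0 <= z x) -> (exists x, z x != 0) ->
    (forall x, lam * z x <= nsum z [set: G] x) ->
  exists u v : G, u != v /\ #|[set r | ~~ (adj u r && adj v r)]|%:R <= kap * lam ^+ 2.
Proof.
move=> eps0 c0 hc hkap kap4 lam2 hl hl4 hn k33 dg z0 [x0 zx0] hz.
have lam0 : 0 < lam by lra.
have lamsq : 0 < lam ^+ 2 by rewrite exprn_gt0.
have ec0 : 0 < eps / c by rewrite divr_gt0.
have eta0 : 0 < eta by lra.
pose L := [set x | eps * lam ^+ 2 <= (deg [set: G] x)%:R].
set l := 30 / eps in hl hl4.
have l0 : 0 < l by rewrite divr_gt0.
have cardL : #|L|%:R <= l.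
  have h1 : #|L|%:R * (eps * lam ^+ 2) <= (degsum [set: G])%:R.
    rewrite mulr_natl -sumr_const /degsum natr_sum big_mkcond [leRHS]big_mkcond.
    apply: ler_sum => x _; rewrite finset.in_setT inE; case: ifP => // _; exact: ler0n.
  have h2 : (degsum [set: G])%:R <= (30 * #|G|)%:R :> R.
    by rewrite ler_nat; have := degsum_le dg [set: G]; rewrite finset.cardsT.
  rewrite natrM in h2; rewrite /l ler_pdivlMr //.
  rewrite -(ler_pM2r lamsq) -mulrA; apply: le_trans h1 _; apply: le_trans h2 _; lra.
set q := sqsum z L; set w := sqsum z (~: L).
have q0 : 0 <= q by exact: sqsum_ge0.
have w0 : 0 <= w by exact: sqsum_ge0.
have qw : sqsum z [set: G] = q + w.
  by rewrite /q /w /sqsum (big_setID L) /= finset.setTI finset.setTD.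
have fL : qform z L L <= l * q.
  by apply: le_trans (qform_card_le L) _; apply: ler_wpM2r.
have fR : qform z (~: L) (~: L) <= eta * lam * w.
  have cl0 : 0 < c * lam by rewrite mulr_gt0.
  apply: le_trans (qform_degenerate_le z cl0 dg _) _.
  rewrite /w /sqsum mulr_sumr; apply: ler_sum => x; rewrite !inE -ltNge => dx.
  apply: ler_wpM2r; first exact: sqr_ge0.
  have h1 : (deg (~: L) x)%:R / (c * lam) <= eps / c * lam.
    rewrite ler_pdivrMr // mulrACA divfK ?gt_eqF // -expr2.
    apply: le_trans (ltW dx); rewrite ler_nat; apply: subset_leq_card.
    by apply/fintype.subsetP => y; rewrite !inE => /andP[].
  have h2 : (15 * c + eps / c) * lam <= eta * lam by apply: ler_wpM2r => //; exact: ltW.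
  by apply: le_trans h2; move: h1; lra.
have tot : lam * (q + w) <= l * q + eta * lam * w + 2 * qform z (~: L) L.
  rewrite -qw; apply: le_trans (qform_ge z0 hz) _.
  rewrite (qform_setCl _ L) !(qform_setCr _ L) [qform z L (~: L)]qformC; lra.
have eta1 : eta < 1 / 96 by lra.
(* If z vanished on L, then lam w <= eta lam w would force z to vanish everywhere. *)
have qpos : 0 < q.
  rewrite lt_neqAle q0 andbT; apply/negP => /eqP q00.
  have zL : forall x, x \in L -> z x = 0 by apply: sqsum_eq0; rewrite -/q -q00.
  have f0 : qform z (~: L) L = 0.
    apply: big1 => x _; rewrite /nsum big1 ?mulr0 // => y yL; by rewrite zL ?mulr0.
  have w00 : w <= 0.
    move: tot; rewrite f0 -q00 => tot.
    have : 0 <= lam * (eta - 1) * w by lra.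
    by rewrite nmulr_rge0 // nmulr_llt0 // ?subr_lt0; lra.
  have zR := sqsum_eq0 w00.
  case/negP: zx0; apply/eqP; case: (boolP (x0 \in L)) => [/zL//|h].
  by apply: zR; rewrite finset.in_setC.
(* With this weight in [amgm] the terms in w cancel in [tot]. *)
set b := (1 - eta) * lam.
have b0 : 0 < b by rewrite mulr_gt0 // subr_gt0; lra.
set Y := \sum_(r in ~: L) nsum z L r ^+ 2.
have hY : (1 - 2 * eta) * lam ^+ 2 * q <= Y.
  have h1 : 2 * qform z (~: L) L <= b * w + Y / b.
    rewrite /qform /w /sqsum /Y !mulr_sumr mulr_suml -big_split /=.
    by apply: ler_sum => r _; exact: amgm.
  have h2 : b * q <= Y / b.
    have : l * q <= eta * lam * q by apply: ler_wpM2r.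
    move: tot h1; rewrite /b; lra.
  rewrite ler_pdivlMr // in h2; apply: le_trans h2.
  have : 0 <= eta ^+ 2 * (lam ^+ 2 * q) by rewrite mulr_ge0 ?sqr_ge0 // mulr_ge0 // ltW.
  rewrite /b; lra.
pose T := [set r | 2 < deg L r]%N.
have cardT : #|T|%:R <= 2 * l ^+ 3.
  apply: le_trans (_ : (2 * #|L| ^ 3)%:R <= _); first by rewrite ler_nat card_many_nbrs.
  by rewrite natrM natrX ler_pM2l //; apply: lerXn2r; rewrite ?nnegrE ?(ltW l0).
have YT : \sum_(r in T) nsum z L r ^+ 2 <= eta * lam ^+ 2 * q.
  apply: le_trans (_ : #|T|%:R * (l * q) <= _).
    rewrite mulr_natl -sumr_const; apply: ler_sum => r _.
    apply: le_trans (nsum_sqr_le _ _) _; apply: ler_wpM2r => //.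
    apply: le_trans cardL; rewrite ler_nat; apply: subset_leq_card.
    by apply/fintype.subsetP => y; rewrite !inE => /andP[].
  apply: le_trans (_ : 2 * l ^+ 3 * (l * q) <= _).
    by apply: ler_wpM2r => //; rewrite mulr_ge0 // ltW.
  have -> : 2 * l ^+ 3 * (l * q) = 2 * l ^+ 4 * q by ring.
  exact: ler_wpM2r.
(* 15/8 lies below the maximum 2 of a vertex with two heavy neighbours, but above 1, the bound for a
   single heavy neighbour, and above 25/16, the bound for a pair other than u, v. *)
pose good := [set r in ~: L :\: T | 15 / 8 * q <= nsum z L r ^+ 2].
have S2 r : r \notin T -> nsum z L r ^+ 2 <= 2 * q.
  rewrite inE -leqNgt => d2; apply: le_trans (nsum_sqr_le _ _) _.
  by apply: ler_wpM2r => //; rewrite ler_nat.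
have Ygood : Y <= eta * lam ^+ 2 * q + (15 / 8 * q * #|G|%:R + q / 8 * #|good|%:R).
  apply: (@le_trans _ _ (\sum_(r in T) nsum z L r ^+ 2 +
     (\sum_(r in [set: G]) 15 / 8 * q + \sum_(r in good) q / 8))).
    rewrite /Y big_mkcond [X in X + _]big_mkcond [X in _ + (X + _)]big_mkcond.
    rewrite [X in _ + (_ + X)]big_mkcond -!big_split /=; apply: ler_sum => r _.
    rewrite finset.in_setT; have s0 := sqr_ge0 (nsum z L r).
    case rL: (r \in ~: L); last first.
      by case: (r \in T); case: (r \in good); move: s0 q0; clear; lra.
    case rT: (r \in T); first by case: (r \in good); move: s0 q0; clear; lra.
    have := S2 r; rewrite rT => /(_ isT) s2.
    rewrite !inE in rL rT; rewrite !inE rL rT /=.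
    by case: ifP => [_|/negbT]; rewrite -?ltNge; move: s0 q0 s2; clear; lra.
  rewrite !sumr_const finset.cardsT (mulr_natr _ #|G|) (mulr_natr _ #|good|).
  exact: lerD YT (lexx _).
(* As #|G| <= lam^2 / 2, the share left for good vertices is 8 (1 - 15/16 - 3 eta) = 1/2 - 24
   eta. *)
have card_good : lam ^+ 2 / 2 - 24 * eta * lam ^+ 2 <= #|good|%:R.
  have h : (1 - 2 * eta) * lam ^+ 2 <= eta * lam ^+ 2 + (15 / 8 * #|G|%:R + #|good|%:R / 8).
    rewrite -(ler_pM2r qpos); apply: le_trans hY _; apply: le_trans Ygood _.
    by rewrite le_eqVlt; apply/orP; left; apply/eqP; field.
  lra.
have [r0 r0g] : exists r0, r0 \in good.
  have : (0 : R) < #|good|%:R.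
    apply: lt_le_trans card_good.
    have -> : lam ^+ 2 / 2 - 24 * eta * lam ^+ 2 = lam ^+ 2 * (1 / 2 - 24 * eta) by field.
    by apply: mulr_gt0 => //; lra.
  by rewrite ltr0n => /card_gt0P.
have nb2 r : r \in good -> exists u v, u != v /\ nbrs L r = [set u; v].
  rewrite !inE => /andP[/andP[dr _] sr].
  have dr2 : deg L r == 2%N.
    rewrite -leqNgt in dr; rewrite eqn_leq dr leqNgt; apply/negP; rewrite ltnS => d1.
    have : nsum z L r ^+ 2 <= 1 * q.
      by apply: le_trans (nsum_sqr_le _ _) _; apply: ler_wpM2r => //; rewrite lern1.
    lra.
  exact/cards2P.
have sr2 r u v : u != v -> nbrs L r = [set u; v] -> nsum z L r = z u + z v.
  move=> uv e; rewrite nsum_nbrs e (big_setU1 u) /= ?inE // big_set1 //.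
have [u [v [uv e0]]] := nb2 _ r0g.
have inL r k : k \in nbrs L r -> k \in L by rewrite inE => /andP[].
have uL : u \in L by apply: (inL r0); rewrite e0 !inE eqxx.
have vL : v \in L by apply: (inL r0); rewrite e0 !inE eqxx orbT.
have zuv : 15 / 16 * q <= z u ^+ 2 + z v ^+ 2.
  move: r0g; rewrite !inE => /andP[_]; rewrite (sr2 _ _ _ uv e0).
  have := sqr_ge0 (z u - z v); lra.
have zk k : k \in L -> k != u -> k != v -> z k ^+ 2 <= q / 16.
  move=> kL ku kv.
  have : z k ^+ 2 + (z u ^+ 2 + z v ^+ 2) <= q.
    have <- : sqsum z [set k; u; v] = z k ^+ 2 + (z u ^+ 2 + z v ^+ 2).
      rewrite /sqsum -finset.setUA !big_setU1 ?inE ?negb_or ?ku ?kv ?uv // big_set1 //.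
    apply: sqsum_sub; apply/fintype.subsetP => y; rewrite finset.in_setU finset.in_set2 finset.in_set1 => /orP[/orP[]|] /eqP-> //.
  lra.
exists u, v; split=> //.
have sub : [set r | ~~ (adj u r && adj v r)] \subset ~: good.
  apply/fintype.subsetP => r; rewrite inE => nr; rewrite inE; apply: contra nr => rg.
  have [a [b' [ab e]]] := nb2 _ rg.
  have srg : 15 / 8 * q <= (z a + z b') ^+ 2.
    by move: rg; rewrite !inE => /andP[_]; rewrite (sr2 _ _ _ ab e).
  have aL : a \in L by apply: (inL r); rewrite e !inE eqxx.
  have bL : b' \in L by apply: (inL r); rewrite e !inE eqxx orbT.
  have zle k : k \in L -> z k ^+ 2 <= q.
    move=> kL; have <- : sqsum z [set k] = z k ^+ 2 by rewrite /sqsum big_set1.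
    by apply: sqsum_sub; rewrite finset.sub1set.
  have inuv a1 b1 : a1 \in L -> b1 \in L -> 15 / 8 * q <= (z a1 + z b1) ^+ 2 -> a1 \in [set u; v].
    move=> a1L b1L h; rewrite !inE; apply: contraT; rewrite negb_or => /andP[au av].
    have h1 := zk _ a1L au av; have h2 := zle _ b1L.
    (* The cross term is at most 4 (z a1)^2 + (z b1)^2 / 4, so the square is at most 5 q / 16 + 5 q
       / 4 = 25 q / 16. *)
    have := sqr_ge0 (2 * z a1 - z b1 / 2); lra.
  have au := inuv a b' aL bL srg.
  have bu : b' \in [set u; v] by apply: (inuv b' a bL aL); rewrite addrC.
  have : [set u; v] = nbrs L r.
    rewrite e; apply/esym/eqP; rewrite eqEcard !cards2 ab uv leqnn andbT.
    by apply/fintype.subsetP => y; rewrite !inE => /orP[]/eqP->; rewrite -finset.in_set2.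
  move=> /setP E; have := E u; have := E v; rewrite !inE !eqxx ?orbT /= => /esym/andP[_ rv] /esym/andP[_ ru].
  by rewrite ![adj _ r]adj_sym ru rv.
have := subset_leq_card sub; rewrite -(ler_nat R) => h; apply: le_trans h _.
have : (#|good| + #|~: good|)%:R = #|G|%:R :> R by rewrite cardsC.
have : 24 * eta * lam ^+ 2 <= kap * lam ^+ 2 by apply: ler_wpM2r => //; exact: ltW.
rewrite natrD; lra.
Qed.

End Hubs.

End TwoHubs.

(** * The exact structure *)

Section ExactStructure.

Local Open Scope ring_scope.

(** The numerical end of [entry_le]. On the right the coefficient of s is about 1.5 lam^2 / 10^4 at
    most and that of M about 34 lam^2 / 10^4, which leaves room for 1 / 5000. *)
Lemma entry_bound (R : realFieldType) (lam d M s : R) :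
    (200 * 100) <= lam -> 0 <= d -> d <= lam ^+ 2 / (100 * 100) -> 0 <= M -> 0 <= s ->
    lam ^+ 2 * M <= (lam + 2 + d) * s + (4 + 34 * d) * M ->
  M <= s / (50 * 100).
Proof.
move=> hl d0 hd M0 s0 h.
have l0 : 0 < lam by lra.
have h1 : (200 * 100) * lam <= lam ^+ 2 by rewrite expr2 ler_pM2r.
have X0 : 0 < lam ^+ 2 by rewrite exprn_gt0.
have h2 : d * M <= lam ^+ 2 / (100 * 100) * M by apply: ler_wpM2r.
have h3 : d * s <= lam ^+ 2 / (100 * 100) * s by apply: ler_wpM2r.
have h4 : lam * s <= lam ^+ 2 / (200 * 100) * s by apply: ler_wpM2r => //; lra.
have h5 : (200 * 100) * s <= lam * s by apply: ler_wpM2r.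
have h6 : lam * M <= lam ^+ 2 / (200 * 100) * M by apply: ler_wpM2r => //; lra.
have h7 : (200 * 100) * M <= lam * M by apply: ler_wpM2r.
rewrite -(ler_pM2l X0); lra.
Qed.

(* [zu] and [zv] are the weights of the hubs and [d] is the number of vertices not joined to
   both; [V] is the variance of the weights on the rim and [P] its weighted degree defect. *)
Lemma energy_balance (R : realFieldType) (lam zu zv m d V P : R) :
    (200 * 100) <= lam -> 0 <= d -> d <= lam ^+ 2 / (100 * 100) -> 0 <= zu -> 0 <= zv ->
    0 < zu + zv -> m = zu \/ m = zv -> 0 <= V -> 0 <= P ->
    lam * (zu - zv) ^+ 2 / 2 + (lam - 2) * V + P + d * (zu + zv) ^+ 2 / (lam - 2) <=
      d * ((m + (zu + zv) / (125 * 10)) ^+ 2 / (9 / 10 * lam)) ->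
  [/\ d <= 0, V <= 0 & P <= 0].
Proof.
move=> hl d0 hd zu0 zv0; set s := zu + zv => s0 hm V0 P0 H.
have l0 : 0 < lam by lra.
have l2 : 0 < lam - 2 by lra.
have sl0 : 0 <= s ^+ 2 / lam by apply: divr_ge0; [exact: sqr_ge0|exact: ltW].
have ms : m <= s by case: hm => ->; rewrite /s; lra.
have m0 : 0 <= m by case: hm => ->.
have s20 : 0 < s ^+ 2 by rewrite exprn_gt0.
have dev (B k : R) : 0 <= B -> B <= k * s -> B ^+ 2 / (9 / 10 * lam) <= k ^+ 2 * 10 / 9 * (s ^+ 2 / lam).
  move=> B0 Bk; have : B ^+ 2 <= (k * s) ^+ 2.
    by apply: lerXn2r; rewrite ?nnegrE //; apply: le_trans Bk.
  move=> h; rewrite ler_pdivrMr; last by rewrite mulr_gt0.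
  apply: le_trans h _; rewrite exprMn le_eqVlt; apply/orP; left; apply/eqP.
  by field; rewrite gt_eqF.
have dq0 : 0 <= d * s ^+ 2 / (lam - 2) by apply: divr_ge0; [apply: mulr_ge0 => //|]; apply: ltW.
have lV0 : 0 <= (lam - 2) * V by apply: mulr_ge0 => //; apply: ltW.
have dl0 : 0 <= lam * (zu - zv) ^+ 2 / 2 by apply: divr_ge0 => //; apply: mulr_ge0; [exact: ltW|exact: sqr_ge0].
(* With m <= s alone, H already gives (zu - zv)^2 <= 2.4 s^2 / 10^4, whereas m > 0.51 s would give
   at least 4 s^2 / 10^4. So the two hubs have nearly equal weights. *)
have m51 : m <= 51 / 100 * s.
  have h1 : d * ((m + s / (125 * 10)) ^+ 2 / (9 / 10 * lam)) <= d * (6 / 5 * (s ^+ 2 / lam)).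
    apply: ler_wpM2l => //; apply: le_trans (dev _ ((10 * 100 + 1) / (10 * 100)) _ _) _; try lra.
  have h2 : d * (6 / 5 * (s ^+ 2 / lam)) <= lam ^+ 2 / (100 * 100) * (6 / 5 * (s ^+ 2 / lam)).
    by apply: ler_wpM2r => //; apply: mulr_ge0.
  have e2 : lam ^+ 2 / (100 * 100) * (6 / 5 * (s ^+ 2 / lam)) = lam * (3 / (250 * 100) * s ^+ 2).
    by field; rewrite gt_eqF.
  have h3 : (zu - zv) ^+ 2 <= 3 / (125 * 100) * s ^+ 2.
    rewrite -(ler_pM2l l0); lra.
  rewrite leNgt; apply/negP => bad.
  have : (2 / 100 * s) ^+ 2 <= (2 * m - s) ^+ 2.
    by apply: lerXn2r; rewrite ?nnegrE; lra.
  have -> : (2 * m - s) ^+ 2 = (zu - zv) ^+ 2 by rewrite /s; case: hm => ->; ring.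
  by rewrite exprMn; lra.
(* Now 0.511^2 * 10 / 9 < 1 / 3, so the right-hand side of H is at most a third of the loss d s^2 /
   (lam - 2) on the left. *)
have h1 : d * ((m + s / (125 * 10)) ^+ 2 / (9 / 10 * lam)) <= d * (1 / 3 * (s ^+ 2 / (lam - 2))).
  apply: ler_wpM2l => //; apply: le_trans (dev _ (511 / (10 * 100)) _ _) _; try lra.
  apply: (@le_trans _ _ (1 / 3 * (s ^+ 2 / lam))).
    by apply: ler_wpM2r; [exact: sl0|lra].
  apply: ler_wpM2l; first by lra.
  apply: ler_wpM2l; first exact: ltW.
  by rewrite lef_pV2 ?posrE //; lra.
have e3 : d * (1 / 3 * (s ^+ 2 / (lam - 2))) = d * s ^+ 2 / (lam - 2) / 3 by ring.
have dq : d * s ^+ 2 / (lam - 2) <= 0 by lra.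
have lV : (lam - 2) * V <= 0 by lra.
split; last by lra.
- by move: dq; rewrite -mulrA pmulr_lle0 // divr_gt0.
- by move: lV; rewrite pmulr_rle0.
Qed.

Section Structure.
Variables (R : realFieldType) (G : sgraph) (z : G -> R) (lam : R) (u v : G).
Implicit Types (S : {set G}) (x y w : G).

Hypotheses (uv : u != v) (nuv : ~~ adj u v) (hl : (200 * 100) <= lam).
Hypothesis hn : lam * (lam - 2) = 2 * (#|G|%:R - 2).
Hypotheses (k33 : K33_free G) (dg : degenerate_by 15 G).
Hypotheses (z0 : forall x, 0 <= z x) (zn0 : exists x, z x != 0).
Hypothesis hz : forall x, lam * z x <= nsum z [set: G] x.

Let C := [set r | adj u r && adj v r].
Let D := [set r | [&& r != u, r != v & ~~ (adj u r && adj v r)]].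
Let s := z u + z v.

Hypothesis hD : #|[set r | ~~ (adj u r && adj v r)]|%:R <= lam ^+ 2 / (100 * 100).

Lemma uC : u \notin C. Proof. by rewrite inE adj_irrefl. Qed.
Lemma vC : v \notin C. Proof. by rewrite inE adj_irrefl andbF. Qed.

Lemma hub_split (V : nmodType) (F : G -> V) :
  \sum_(x in [set: G]) F x = F u + F v + (\sum_(x in C) F x + \sum_(x in D) F x).
Proof.
rewrite (bigD1 u) ?inE //= (bigD1 v) /=; last by rewrite inE eq_sym.
rewrite (bigID (mem C)) /= addrA; congr (_ + (_ + _)); apply: eq_bigl => x.
  rewrite !inE /=; case: (x =P u) => [->|_]; first by rewrite adj_irrefl.
  by case: (x =P v) => [->|_] //; rewrite adj_irrefl !andbF.
by rewrite !inE /= andbA.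
Qed.

Lemma CD_notuv w : (w \in C) || (w \in D) -> (w != u) && (w != v).
Proof.
case/orP; last by rewrite inE => /and3P[-> ->].
by move=> wC; apply/andP; split; apply: contraTneq wC => ->; [exact: uC|exact: vC].
Qed.

(** Neighbours of w in C are common neighbours of u, v and w. *)
Lemma degC2 w : w != u -> w != v -> (deg C w <= 2)%N.
Proof.
move=> wu wv; apply: leq_trans (k33 (a := u) (b := v) (c := w) uv _ _); last 2 first.
- by rewrite eq_sym.
- by rewrite eq_sym.
by apply: subset_leq_card; apply/fintype.subsetP => y; rewrite !inE andbA.
Qed.

Lemma degD_le w : (deg D w <= #|D|)%N.
Proof. by apply: subset_leq_card; apply/fintype.subsetP => y; rewrite inE => /andP[]. Qed.

Lemma d_le : #|D|%:R <= lam ^+ 2 / (100 * 100).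
Proof.
apply: le_trans hD; rewrite ler_nat; apply: subset_leq_card.
by apply/fintype.subsetP => y; rewrite !inE => /and3P[].
Qed.

Let a x : R := adjr R x u * z u + adjr R x v * z v.

Lemma nsumT x : nsum z [set: G] x = a x + (nsum z C x + nsum z D x).
Proof. by rewrite /nsum hub_split. Qed.

Lemma adjr01 x y : 0 <= adjr R x y <= 1.
Proof. by rewrite /adjr; case: (adj x y); rewrite lexx ler01. Qed.

Lemma a_le x : a x <= s.
Proof.
by rewrite /a /s; apply: lerD; apply: ler_piMl => //; case/andP: (adjr01 x u) (adjr01 x v) => _ ? /andP[].
Qed.

Lemma nsum_le S x (M : R) : (forall y, y \in S -> z y <= M) -> nsum z S x <= (deg S x)%:R * M.
Proof.
move=> hM; rewrite nsum_nbrs mulr_natl -sumr_const; apply: ler_sum => y.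
by rewrite inE => /andP[/hM].
Qed.

(** The inequality for z is applied twice, at a vertex of largest weight outside the hubs and at its
    neighbours. Its neighbours in D are bounded by the sum over all of D: the degrees inside D add
    up to at most 30 #|D|, while a single one may be large. *)
Lemma entry_le w : (w \in C) || (w \in D) -> z w <= s / (50 * 100).
Proof.
move=> wW; pose W := [set x | (x \in C) || (x \in D)].
have wW' : w \in W by rewrite inE.
pose w0 := [arg max_(i > w in W) z i]%O.
have [w0W hM] : (w0 \in C) || (w0 \in D) /\ forall y, (y \in C) || (y \in D) -> z y <= z w0.
  rewrite /w0; case: (arg_maxP (P := fun i => i \in W) z wW') => i iW hi.
  by split=> [|y yW]; [rewrite inE in iW|apply: hi; rewrite inE].
apply: le_trans (hM _ wW) _; set M := z w0 in hM *.
have hMC y : y \in C -> z y <= M by move=> yC; apply: hM; rewrite yC.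
have hMD y : y \in D -> z y <= M by move=> yD; apply: hM; rewrite yD orbT.
have M0 : 0 <= M by exact: z0.
set d : R := #|D|%:R.
have d0 : 0 <= d by exact: ler0n.
have l0 : 0 < lam by move: hl; lra.
have s0 : 0 <= s by rewrite addr_ge0.
have step y : (y \in C) || (y \in D) -> lam * z y <= s + (2 + (deg D y)%:R) * M.
  move=> /CD_notuv/andP[yu yv]; apply: le_trans (hz y) _; rewrite nsumT.
  apply: lerD; first exact: a_le.
  rewrite mulrDl; apply: lerD.
    apply: le_trans (nsum_le y hMC) _; apply: ler_wpM2r => //.
    by rewrite ler_nat degC2.
  exact: nsum_le.
have sC : lam * nsum z C w0 <= 2 * (s + (2 + d) * M).
  have t0 : 0 <= s + (2 + d) * M by rewrite addr_ge0 // mulr_ge0 // addr_ge0.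
  apply: (@le_trans _ _ ((deg C w0)%:R * (s + (2 + d) * M))); last first.
    by apply: ler_wpM2r => //; rewrite ler_nat; have /andP[? ?] := CD_notuv w0W; exact: degC2.
  rewrite nsum_nbrs mulr_sumr mulr_natl -sumr_const; apply: ler_sum => y.
  rewrite inE => /andP[yC _]; apply: le_trans (step y _) _; first by rewrite yC.
  by rewrite lerD2l; apply: ler_wpM2r => //; rewrite lerD2l ler_nat degD_le.
have sD : lam * nsum z D w0 <= d * s + 32 * d * M.
  rewrite nsum_nbrs mulr_sumr.
  apply: (@le_trans _ _ (\sum_(y in D) (s + (2 + (deg D y)%:R) * M))).
    rewrite [leRHS](bigID (fun y => adj w0 y)) /=.
    rewrite [leLHS](eq_bigl (fun y => (y \in D) && adj w0 y)); last first.
      by move=> y; rewrite inE.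
    rewrite -[leLHS]addr0; apply: lerD.
      by apply: ler_sum => y /andP[yD _]; apply: step; rewrite yD orbT.
    by apply: sumr_ge0 => y _; rewrite addr_ge0 // mulr_ge0 // addr_ge0.
  rewrite big_split sumr_const /= -mulr_suml big_split sumr_const /= -natr_sum.
  have : (degsum D)%:R <= (30 * #|D|)%:R :> R by rewrite ler_nat; have := degsum_le dg D.
  rewrite natrM -/d -/(degsum D) => hd.
  have : (degsum D)%:R * M <= 30 * d * M by apply: ler_wpM2r.
  rewrite -[s *+ _]mulr_natl -[2 *+ _]mulr_natl -/d; lra.
apply: (entry_bound (lam := lam) (d := d)) => //; first exact: d_le.
have : lam * (lam * M) <= lam * (s + (nsum z C w0 + nsum z D w0)).
  rewrite ler_pM2l //; apply: le_trans (hz w0) _; rewrite nsumT lerD2r; exact: a_le.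
move: sC sD; lra.
Qed.

Lemma hub_structure w : w != u -> w != v -> [/\ adj u w, adj v w & deg C w = 2%N].
Proof.
have l0 : 0 < lam by move: hl; lra.
have l2 : 0 < lam - 2 by move: hl; lra.
have s00 : 0 <= s by rewrite addr_ge0.
have s0 : 0 < s.
  rewrite lt_neqAle s00 andbT; apply/negP => /eqP s0.
  have [x /negP] := zn0; apply; apply/eqP/le_anti; rewrite z0 andbT.
  have := z0 u; have := z0 v; move: s0; rewrite /s => s0 zv zu.
  have [->|xu] := eqVneq x u; first by lra.
  have [->|xv] := eqVneq x v; first by lra.
  have := @entry_le x; rewrite !inE xu xv /= orbN => /(_ isT); rewrite /s; lra.
set d : R := #|D|%:R.
pose m := if z v <= z u then z u else z v.
have hm : m = z u \/ m = z v by rewrite /m; case: ifP; [left|right].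
have [mu mv] : z u <= m /\ z v <= m.
  by rewrite /m; case: ifP => h //; split=> //; move/negbT: h; rewrite -ltNge => /ltW.
have m0 : 0 <= m by apply: le_trans mu.
(* A vertex of D sees at most one hub, of weight at most m, and at most two vertices of C, of weight
   at most s / 5000 each. *)
pose B := m + s / (125 * 10).
(* The rim weight in the exact double wheel: it solves lam tau = s + 2 tau. *)
pose tau := s / (lam - 2).
pose V := \sum_(x in C) (z x - tau) ^+ 2.
pose P := \sum_(x in C) (2 - (deg C x)%:R) * z x ^+ 2.
set sg := \sum_(x in C) z x.
have nCu x : x = u \/ x = v -> nsum z C x = sg.
  move=> xuv; apply: eq_bigr => y; rewrite inE => /andP[uy vy].
  by case: xuv => ->; rewrite /adjr ?uy ?vy mul1r.
have au : a u = 0 by rewrite /a /adjr adj_irrefl (negPf nuv) !mul0r addr0.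
have av : a v = 0 by rewrite /a /adjr adj_irrefl adj_sym (negPf nuv) !mul0r addr0.
have aC x : x \in C -> a x = s.
  by rewrite inE /a /adjr ![adj x _]adj_sym => /andP[-> ->]; rewrite !mul1r.
have aD x : x \in D -> a x <= m.
  rewrite inE /a /adjr ![adj x _]adj_sym => /and3P[_ _].
  by case: (adj u x); case: (adj v x); rewrite // ?mul1r ?mul0r ?addr0 ?add0r.
have Duv : z u * nsum z D u + z v * nsum z D v = \sum_(x in D) a x * z x.
  rewrite /nsum !mulr_sumr -big_split /=; apply: eq_bigr => x _.
  by rewrite /a ![adjr R x _]adjrC; ring.
have QCD : qform z C D = \sum_(x in D) z x * nsum z C x by rewrite qformC.
have tot : lam * (z u ^+ 2 + z v ^+ 2 + (sqsum z C + sqsum z D)) <=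
    2 * s * sg + qform z C C + 2 * (\sum_(x in D) (a x + nsum z C x) * z x) + qform z D D.
  have := qform_ge z0 hz; rewrite /sqsum hub_split -!/(sqsum z _) => h; apply: le_trans h _.
  rewrite /qform hub_split !nsumT au av !nCu; [|by right|by left].
  have -> : \sum_(x in C) z x * nsum z [set: G] x = s * sg + qform z C C + qform z C D.
    rewrite /sg mulr_sumr /qform -!big_split /=; apply: eq_bigr => x xC.
    by rewrite nsumT (aC _ xC); ring.
  have -> : \sum_(x in D) z x * nsum z [set: G] x =
      \sum_(x in D) (a x + nsum z C x) * z x + qform z D D.
    by rewrite /qform -!big_split /=; apply: eq_bigr => x xD; rewrite nsumT; ring.
  have -> : \sum_(x in D) (a x + nsum z C x) * z x = \sum_(x in D) a x * z x + qform z C D.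
    by rewrite QCD -big_split /=; apply: eq_bigr => x _; ring.
  rewrite -Duv -/(qform z C C) -/(qform z D D) /s le_eqVlt; apply/orP; left; apply/eqP; ring.
(* The shares 9/10 here and 1/10 in [fDD] add up to lam, so that [sqsum z D] cancels and only the
   term in B remains. *)
have fD : 2 * (\sum_(x in D) (a x + nsum z C x) * z x) <=
    9 / 10 * lam * sqsum z D + d * (B ^+ 2 / (9 / 10 * lam)).
  have e0 : 0 < 9 / 10 * lam by rewrite mulr_gt0.
  rewrite /sqsum !mulr_sumr /d (mulr_natl _ #|D|) -sumr_const -big_split /=; apply: ler_sum => x xD.
  apply: le_trans (amgm (z x) B e0); rewrite ler_pM2l // mulrC; apply: ler_wpM2l => //.
  apply: lerD; first exact: aD.
  apply: le_trans (nsum_le (M := s / (50 * 100)) x _) _; first by move=> y yC; apply: entry_le; rewrite yC.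
  have : (deg C x)%:R <= 2 :> R.
    by rewrite ler_nat; move: xD; rewrite inE => /and3P[? ? _]; exact: degC2.
  move=> h; have : (deg C x)%:R * (s / (50 * 100)) <= 2 * (s / (50 * 100)).
    by apply: ler_wpM2r => //; rewrite divr_ge0.
  move: s00; lra.
have fDD : qform z D D <= 1 / 10 * lam * sqsum z D.
  (* This weight bounds the two terms by 15 lam / 400 and lam / 25, since #|D| <= lam^2 / 10^4;
     together they stay below lam / 10. *)
  have e0 : 0 < lam / 400 by rewrite divr_gt0.
  apply: le_trans (qform_degenerate_le z e0 dg _) _.
  rewrite /sqsum mulr_sumr; apply: ler_sum => x xD; apply: ler_wpM2r; first exact: sqr_ge0.
  have : (deg D x)%:R / (lam / 400) <= lam / 25.
    rewrite ler_pdivrMr //; have := d_le; have : (deg D x)%:R <= d by rewrite ler_nat degD_le.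
    rewrite -/d expr2; lra.
  move: l0; lra.
have fCC : qform z C C = 2 * sqsum z C - P - (\sum_(x in C) (deg C x)%:R * z x ^+ 2 - qform z C C).
  suff -> : P = 2 * sqsum z C - \sum_(x in C) (deg C x)%:R * z x ^+ 2 by ring.
  by rewrite /P /sqsum mulr_sumr -sumrB; apply: eq_bigr => x _; ring.
have fC := qform_deg_le z C.
(* The square is completed at tau. By [hn] its constant term is lam s^2 / 2 minus d s^2 / (lam - 2);
   the first part cancels against the hub energy in [eS], and the second is the loss caused by D. *)
have VE : (lam - 2) * V = (lam - 2) * sqsum z C - 2 * s * sg + #|C|%:R * (s ^+ 2 / (lam - 2)).
  have -> : V = sqsum z C - 2 * tau * sg + #|C|%:R * tau ^+ 2.
    rewrite /V /sqsum /sg mulr_sumr (mulr_natl _ #|C|) -sumr_const -sumrB -big_split /=.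
    by apply: eq_bigr => x _; ring.
  by rewrite /tau; field; rewrite gt_eqF.
have cardC : #|C|%:R = lam * (lam - 2) / 2 - d.
  have : #|G|%:R = 2 + (#|C|%:R + d) :> R.
    have := hub_split (fun=> 1 : R); rewrite !sumr_const finset.cardsT => ->; rewrite /d; lra.
  by rewrite hn => ->; field.
have cE : #|C|%:R * (s ^+ 2 / (lam - 2)) = lam * s ^+ 2 / 2 - d * s ^+ 2 / (lam - 2).
  by rewrite cardC; field; rewrite gt_eqF.
have P0 : 0 <= P.
  apply: sumr_ge0 => x xC; rewrite mulr_ge0 ?sqr_ge0 // subr_ge0 ler_nat.
  by have /andP[? ?] := @CD_notuv x (introT orP (or_introl xC)); exact: degC2.
have V0 : 0 <= V by apply: sumr_ge0 => x _; exact: sqr_ge0.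
have [d0 V00 P00] : [/\ d <= 0, V <= 0 & P <= 0].
  apply: (energy_balance (lam := lam) (zu := z u) (zv := z v) (m := m)) => //.
  - exact: d_le.
  - have eS : lam * (z u ^+ 2 + z v ^+ 2) = lam * s ^+ 2 / 2 + lam * (z u - z v) ^+ 2 / 2.
      by rewrite /s; field.
    move: tot fD fDD fC fCC VE cE eS; rewrite -/s -/B.
    move: (qform z C C) (qform z D D) (sqsum z C) (sqsum z D) (\sum_(x in C) _).
    move: (\sum_(x in D) _) (s ^+ 2 / _) (lam * (_ - _) ^+ 2 / 2) (lam * s ^+ 2 / 2).
    move=> *; lra.
have D0 : D = finset.set0.
  apply/eqP; rewrite -cards_eq0 -leqn0; move: d0; rewrite /d.
  by rewrite -[0]/(0%:R) ler_nat.
move=> wu wv.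
have wC : w \in C.
  have : w \notin D by rewrite D0 inE.
  by rewrite !inE wu wv /= negbK.
have zw : z w = tau.
  apply/eqP; rewrite -subr_eq0 -sqrf_eq0; apply/eqP/le_anti; rewrite sqr_ge0 andbT.
  apply: le_trans V00; rewrite /V (big_setD1 w wC) /= lerDl.
  by apply: sumr_ge0 => x _; exact: sqr_ge0.
have : (2 - (deg C w)%:R) * z w ^+ 2 <= 0.
  apply: le_trans P00; rewrite /P (big_setD1 w wC) /= lerDl.
  apply: sumr_ge0 => x; rewrite inE => /andP[_ xC]; rewrite mulr_ge0 ?sqr_ge0 // subr_ge0 ler_nat.
  by have /andP[? ?] := @CD_notuv x (introT orP (or_introl xC)); exact: degC2.
rewrite pmulr_lle0; last by rewrite zw exprn_gt0 // divr_gt0.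
rewrite subr_le0 ler_nat => d2.
have := wC; rewrite inE => /andP[-> ->]; split=> //.
by apply/eqP; rewrite eqn_leq d2 degC2.
Qed.

End Structure.

End ExactStructure.

(** * Recognising the double wheel *)

Section WheelShape.

Definition double_wheel m := join (dunion (complete 1) (complete 1)) (cycle_graph m).

Lemma iso_from (G H : sgraph) (g : H -> G) :
  bijective g -> (forall x y, adj (g x) (g y) = adj x y) -> sgraph_iso G H.
Proof.
by case=> f gK fK hg; exists f => [|x y]; [exists g|rewrite -hg !fK].
Qed.

Lemma succ_mod k m : k < m -> k.+1 %% m = if k.+1 == m then 0 else k.+1.
Proof. by case: eqP => [->|/eqP ne km]; [rewrite modnn|rewrite modn_small // ltn_neqAle ne]. Qed.

(** k is the cyclic predecessor of i, and 2 < m keeps it apart from the successor. *)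
Lemma pred_mod i m (k := if i == 0 then m.-1 else i.-1) : 2 < m -> i < m ->
  [/\ k < m, k.+1 %% m = i & i.+1 %% m != k].
Proof.
move=> m2 im; have km : k < m by rewrite /k; case: eqP => _; lia.
split=> //; rewrite succ_mod //.
  by rewrite /k; case: (i =P 0) => i0; case: eqP => h; lia.
by rewrite /k; case: (i =P 0) => i0; case: (i.+1 =P m) => h; lia.
Qed.

Lemma pred_neq_succ j : j.-1 <> j.+1. Proof. lia. Qed.

Section Wheel.
Variable G : sgraph.
Implicit Types (x y w : G).

Lemma connected_seq x p : path (@adj G) x p -> connected_set [set y in x :: p].
Proof.
elim/last_ind: p => [_|p z IH].
  have -> : [set y in [:: x]] = [set x] by apply/setP => y; rewrite !inE.
  exact: connected_single.
rewrite rcons_path => /andP[xp lz].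
have -> : [set y in x :: rcons p z] = z |: [set y in x :: p].
  by apply/setP => y; rewrite !inE mem_rcons inE orbCA.
by apply: (connected_add (u := last x p)); [exact: IH|rewrite inE mem_last|].
Qed.

Lemma in_nbrs (S : {set G}) x y : (y \in nbrs S x) = (y \in S) && adj x y.
Proof. by rewrite inE. Qed.

Variables (u v : G).
Hypotheses (uv : u != v) (nuv : ~~ adj u v).
Let C := [set r | adj u r && adj v r].
Hypothesis hub : forall w, w != u -> w != v -> [/\ adj u w, adj v w & deg C w = 2].
Hypothesis noK5 : forall s : seq {set G}, clique_minor s -> size s <> 5.
Hypothesis big : 2 < #|G|.

Lemma rimP w : (w \in C) = (w != u) && (w != v).
Proof.
apply/idP/andP => [wC|[wu wv]]; last by rewrite inE; have [-> -> _] := hub wu wv.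
by split; apply: contraTneq wC => ->; rewrite inE adj_irrefl ?andbF.
Qed.

Lemma card_rim : #|C| = #|G| - 2.
Proof.
have -> : C = ~: [set u; v] by apply/setP => w; rewrite rimP !inE negb_or.
by rewrite cardsCs finset.setCK cards2 uv.
Qed.

Lemma deg_rim w : w \in C -> deg C w = 2.
Proof. by rewrite rimP => /andP[wu wv]; have [] := hub wu wv. Qed.

Lemma longest_path : exists s, [/\ uniq s, {subset s <= C}, sorted (@adj G) s, 2 < size s &
  forall w, w \in C -> w \notin s -> ~~ adj (last u s) w].
Proof.
pose P k := [exists s : k.-tuple G, [&& uniq s, all (mem C) s & sorted (@adj G) s]].
have P3 : P 3.
  have [c cC] : exists c, c \in C by apply/card_gt0P; rewrite card_rim subn_gt0.
  have /eqP := deg_rim cC; rewrite /deg => /cards2P[a [b [ab e]]].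
  have : a \in nbrs C c by rewrite e !inE eqxx.
  have : b \in nbrs C c by rewrite e !inE eqxx orbT.
  rewrite !in_nbrs => /andP[bC cb] /andP[aC ca].
  have ac : a != c by apply: contraTneq ca => ->; rewrite adj_irrefl.
  have bc : c != b by apply: contraTneq cb => ->; rewrite adj_irrefl.
  apply/existsP; exists [tuple a; c; b]; rewrite /= !inE negb_or ac ab bc.
  by move: cC aC bC; rewrite !inE => -> -> ->; rewrite [adj a c]adj_sym ca cb.
have bd k : P k -> k <= #|G|.
  by case/existsP=> s /and3P[us _ _]; rewrite -(size_tuple s) -(card_uniqP us) max_card.
have [m /existsP[s /and3P[us sC ss]] hm] := ex_maxnP (ex_intro _ 3 P3) bd.
exists s; split=> //; first by move=> y ys; have /allP := sC; apply.
  by rewrite size_tuple; exact: hm.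
move=> w wC ws; apply/negP => lw.
suff : P m.+1 by move/hm; rewrite ltnn.
apply/existsP; exists [tuple of rcons s w]; rewrite /= rcons_uniq ws us all_rcons sC andbT /=.
rewrite wC /=.
case: (tval s) ss lw => //= a q aq lw.
by rewrite rcons_path aq lw.
Qed.

Lemma wheel_iso : sgraph_iso G (double_wheel (#|G| - 2)).
Proof.
have [s [us sC ss m2 maxs]] := longest_path.
set m := size s in m2.
pose x i := nth u s i.
have xs i : i < m -> x i \in s by move=> im; rewrite mem_nth.
have xC i : i < m -> x i \in C by move=> /xs /sC.
have xinj i j : i < m -> j < m -> x i = x j -> i = j.
  by move=> im jm /eqP; rewrite nth_uniq // => /eqP.
have adjS i : i.+1 < m -> adj (x i) (x i.+1) by move=> im; exact: (sortedP u ss).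
have m1 : m.-1 < m by rewrite prednK // (ltn_trans _ m2).
have lm2 : 1 < m.-1 by rewrite -ltnS prednK // (ltn_trans _ m2).
have lastE : last u s = x m.-1 by rewrite /x nth_last.
have nbr2 i a b : i < m -> a \in C -> b \in C -> a != b -> adj (x i) a -> adj (x i) b ->
    nbrs C (x i) = [set a; b].
  move=> im aC bC ab ia ib; apply/esym/eqP; rewrite eqEcard cards2 ab.
  rewrite -/(deg C (x i)) deg_rim ?xC // leqnn andbT.
  by apply/fintype.subsetP => y; rewrite !inE => /orP[]/eqP->; rewrite ?ia ?ib ?andbT;
    [move: aC|move: bC]; rewrite inE.
(* The last vertex has a second rim neighbour, which lies on the path by maximality. It cannot be an
   inner vertex, whose two rim neighbours are already its neighbours on the path. *)
have closing : adj (x m.-1) (x 0).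
  have : 1 < deg C (x m.-1) by rewrite deg_rim // xC.
  have mm : m.-2.+1 = m.-1 by case: (m) m2 => [|[]].
  rewrite /deg (cardsD1 (x m.-2)) => h.
  have /card_gt0P[y] : 0 < #|nbrs C (x m.-1) :\ x m.-2|.
    by move: h; case: (_ \in _); rewrite ?add1n ?add0n // => /ltnW.
  rewrite finset.in_setD1 => /andP[ym]; rewrite in_nbrs => /andP[yC my].
  have ys : y \in s.
    by apply: contraT => ys; have := maxs y yC ys; rewrite lastE my.
  pose j := index y s.
  have jm : j < m by rewrite index_mem.
  have yE : y = x j by rewrite /x nth_index.
  rewrite yE in my ym *.
  have jne1 : j != m.-1 by apply: contraTneq my => ->; rewrite adj_irrefl.
  have jne2 : j != m.-2 by apply: contra ym => /eqP->.
  have j1m : j.+1 < m.-1.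
    have jl : j < m.-1 by rewrite ltn_neqAle jne1 -ltnS prednK // (ltn_trans _ m2).
    by rewrite ltn_neqAle jl andbT; apply: contraNneq jne2 => <-.
  case: (posnP j) => [j0|jpos]; first by rewrite -j0.
  have jp : j.-1 < m by apply: leq_ltn_trans (leq_pred _) jm.
  have j1 : j.+1 < m by apply: ltn_trans j1m m1.
  have E := @nbr2 j (x j.-1) (x j.+1) jm (xC _ jp) (xC _ j1).
  have : x m.-1 \in nbrs C (x j) by rewrite in_nbrs xC // adj_sym my.
  rewrite E ?adjS //; last 2 first.
  - by apply/eqP => /xinj; rewrite jp j1 => /(_ isT isT)/pred_neq_succ.
  - by rewrite adj_sym -{2}(prednK jpos) adjS // prednK.
  rewrite !inE => /orP[]/eqP /xinj; rewrite m1 ?jp ?j1 => /(_ isT isT) e; move: j1m; rewrite e ?ltnn // ltnNge.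
  by rewrite (leq_trans (leq_pred _)).
(* For a rim vertex w off the cycle, the sets {x 0}, {x 1}, the rest of the cycle, {u, w} and {v}
   form a K_5 minor: w supplies the missing edge between the hubs. *)
have sall w : w \in C -> w \in s.
  move=> wC; apply: contraT => ws; exfalso.
  have xuv i : i < m -> (x i != u) && (x i != v) by move=> im; rewrite -rimP xC.
  have adju a : a \in C -> adj u a by rewrite inE => /andP[].
  have adjv a : a \in C -> adj v a by rewrite inE => /andP[].
  have [x0 x1 x2] : [/\ 0 < m, 1 < m & 2 < m] by split=> //; apply: ltn_trans m2.
  have sE : s = x 0 :: x 1 :: drop 2 s.
    by rewrite /x -(drop_nth u (n := 1)) // -(drop_nth u (n := 0)) ?drop0.
  have dE : drop 2 s = x 2 :: drop 3 s by rewrite (drop_nth u).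
  set T := [set y in drop 2 s].
  have cT : connected_set T.
    rewrite /T dE; apply: connected_seq.
    have : sorted (@adj G) (drop 2 s) by apply: drop_sorted.
    by rewrite dE.
  have us' := us; rewrite sE /= inE negb_or in us'.
  case/and3P: us' => /andP[n01 n0d] n1d _.
  have dC y : y \in drop 2 s -> y \in C by move/mem_drop/sC.
  have nu : u \notin C by rewrite rimP eqxx.
  have nv : v \notin C by rewrite rimP eqxx andbF.
  have hx2 : x 2 \in T by rewrite finset.in_set dE mem_head.
  have hxl : x m.-1 \in T.
    rewrite finset.in_set; have -> : x m.-1 = nth u (drop 2 s) (m.-1 - 2).
      by rewrite nth_drop subnKC.
    by rewrite mem_nth // size_drop -/m ltn_sub2r.
  have xw i : i < m -> x i != w by move=> im; apply: contraNneq ws => <-; exact: xs.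
  have wuv : (w != u) && (w != v) by rewrite -rimP.
  apply: (noK5 (s := [:: [set x 0]; [set x 1]; T; [set u; w]; [set v]])) => //; split.
    move=> A; rewrite !inE => /or4P[|||/orP[]] /eqP-> //; try exact: connected_single.
    rewrite finset.setUC; apply: connected_add (connected_single u) _ _; first by rewrite inE.
    exact: adju.
  have tch (A B : {set G}) a b : a \in A -> b \in B -> adj a b ->
      (forall y, y \in A -> y \notin B) -> touch A B.
    move=> aA bB ab dis; apply/andP; split.
      by rewrite finset.disjoints_subset; apply/fintype.subsetP => y yA; rewrite inE dis.
    by apply/existsP; exists a; rewrite aA; apply/existsP; exists b; rewrite bB.
  have [/andP[x0u x0v] /andP[x1u x1v]] := (xuv 0 x0, xuv 1 x1).
  have TC y : y \in T -> [/\ y != u, y != v & y != w].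
    rewrite finset.in_set => yd; have yC := dC _ yd; move: (yC); rewrite rimP => /andP[-> ->].
    by split=> //; apply: contraNneq ws => <-; exact: mem_drop yd.
  have e1 (a : G) : a \in [set a] by rewrite inE.
  have uE : u \in [set u; w] by rewrite !inE eqxx.
  have wE : w \in [set u; w] by rewrite !inE eqxx orbT.
  have d1 (a : G) (B : {set G}) : a \notin B -> forall y, y \in [set a] -> y \notin B.
    by move=> aB y; rewrite inE => /eqP->.
  rewrite /= !andbT; apply/andP; split; [|apply/andP; split; [|apply/andP; split]].
  - apply/and4P; split.
    + by apply: (tch _ _ (x 0) (x 1)); rewrite ?adjS //; apply: d1; rewrite inE.
    + apply: (tch _ _ (x 0) (x m.-1)) => //; first by rewrite adj_sym.
      by apply: d1; rewrite finset.in_set.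
    + apply: (tch _ _ (x 0) u) => //; first by rewrite adj_sym adju ?xC.
      by apply: d1; rewrite !inE negb_or x0u xw.
    + apply: (tch _ _ (x 0) v) => //; first by rewrite adj_sym adjv ?xC.
      by apply: d1; rewrite !inE.
  - apply/and3P; split.
    + apply: (tch _ _ (x 1) (x 2)) => //; first exact: adjS.
      by apply: d1; rewrite finset.in_set.
    + apply: (tch _ _ (x 1) u) => //; first by rewrite adj_sym adju ?xC.
      by apply: d1; rewrite !inE negb_or x1u xw.
    + apply: (tch _ _ (x 1) v) => //; first by rewrite adj_sym adjv ?xC.
      by apply: d1; rewrite !inE.
  - apply/andP; split.
    + apply: (tch _ _ (x 2) u) => //; first by rewrite adj_sym adju ?xC.
      by move=> y /TC[yu _ yw]; rewrite !inE negb_or yu yw.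
    + apply: (tch _ _ (x 2) v) => //; first by rewrite adj_sym adjv ?xC.
      by move=> y /TC[_ yv _]; rewrite !inE.
  - apply: (tch _ _ w v) => //; first by rewrite adj_sym adjv.
    by move=> y; rewrite !inE => /orP[]/eqP->; rewrite ?uv //; case/andP: wuv.
have Cm : #|C| = m.
  rewrite /m -(card_uniqP us); apply: eq_card => y; apply/idP/idP; [exact: sall|exact: sC].
rewrite -card_rim Cm.
have m0 : 0 < m by exact: leq_ltn_trans m2.
have sadj i : i < m -> adj (x i) (x (i.+1 %% m)).
  move=> im; rewrite succ_mod //; case: eqP => [e|ne]; last by apply: adjS; move: im ne; lia.
  by rewrite (_ : i = m.-1) // -e.
have sm i : i.+1 %% m < m by rewrite ltn_mod.
have adjx i j : i < m -> j < m ->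
    adj (x i) (x j) = (i != j) && ((j == i.+1 %% m) || (i == j.+1 %% m)).
  move=> im jm; apply/idP/andP => [ij|[_ /orP[]/eqP->]]; last 2 first.
  - exact: sadj.
  - by rewrite adj_sym sadj.
  split; first by apply: contraTneq ij => ->; rewrite adj_irrefl.
  have [km ki ksi] := pred_mod m2 im; set k := if _ then _ else _ in km ki ksi.
  have E := @nbr2 i (x (i.+1 %% m)) (x k) im (xC _ (sm i)) (xC _ km).
  have : x j \in nbrs C (x i) by rewrite in_nbrs xC.
  rewrite E ?sadj //; last 2 first.
  - by apply/eqP => /xinj; rewrite sm km => /(_ isT isT)/eqP; apply/negP.
  - by have := sadj k km; rewrite ki adj_sym.
  rewrite !inE => /orP[]/eqP /xinj; rewrite jm ?sm ?km => /(_ isT isT) ->.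
    by rewrite eqxx.
  by rewrite ki eqxx orbT.
pose g (y : double_wheel m) : G :=
  match y with inl (inl _) => u | inl (inr _) => v | inr i => x i end.
have ginj : injective g.
  have nu : u \notin C by rewrite rimP eqxx.
  have nv : v \notin C by rewrite rimP eqxx andbF.
  have xu i : i < m -> x i <> u by move=> im e; case/negP: nu; rewrite -e xC.
  have xv i : i < m -> x i <> v by move=> im e; case/negP: nv; rewrite -e xC.
  have uv' : u <> v by apply/eqP.
  case=> [[a|a]|i] [[b|b]|j] //=.
  - by rewrite !ord1.
  - by move/esym/xu; case: (ltn_ord j).
  - by move=> e; case: uv'.
  - by rewrite !ord1.
  - by move/esym/xv; case: (ltn_ord j).
  - by move/xu; case: (ltn_ord i).
  - by move/xv; case: (ltn_ord i).
  - by move/xinj => /(_ (ltn_ord i) (ltn_ord j))/val_inj->.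
apply: (@iso_from _ _ g).
  apply: (inj_card_bij ginj); rewrite !card_sum !card_ord -Cm card_rim; move: big; lia.
have adju a : a \in C -> adj u a by rewrite inE => /andP[].
have adjv a : a \in C -> adj v a by rewrite inE => /andP[].
case=> [[a|a]|i] [[b|b]|j] /=; rewrite ?adj_irrefl ?(negPf nuv) //.
- by rewrite !ord1.
- by rewrite adju ?xC.
- by rewrite adj_sym (negPf nuv).
- by rewrite !ord1.
- by rewrite adjv ?xC.
- by rewrite adj_sym adju ?xC.
- by rewrite adj_sym adjv ?xC.
- by rewrite adjx.
Qed.

End Wheel.

End WheelShape.

(** * Drawing the double wheel *)

Section WheelDrawing.

Lemma cycle_adjE m (i j : cycle_graph m) : 2 < m ->
  adj i j = [|| i.+1 == j :> nat, j.+1 == i :> nat, (i == 0 :> nat) && (j.+1 == m)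
    | (j == 0 :> nat) && (i.+1 == m)].
Proof.
case: i j => [i im] [j jm] m2; rewrite /= /cycle_rel -val_eqE /= !succ_mod //.
case: (i.+1 =P m) => hi; case: (j.+1 =P m) => hj; lia.
Qed.

(** Every edge has only two common neighbours: a spoke has the two rim neighbours of its rim end,
    and a rim edge has the two hubs, as the rim contains no triangle. Three pages thus give a
    contradiction. *)
Lemma book_free_wheel m p : 4 < m -> 3 <= p -> is_free (book p) (double_wheel m).
Proof.
move=> m4 p3 [f finj fadj].
pose c (k : 'I_3) : book p := inr (widen_ord p3 k).
have cinj k l : k != l -> f (c k) != f (c l).
  move=> kl; apply: contra_neq kl => /finj.
  by move/(congr1 (fun y => if y is inr o then val o else 0)) => h; apply: val_inj.
pose a : book p := inl ord0; pose b : book p := inl ord_max.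
have ab : adj (f a) (f b) by apply: fadj.
have ac k : adj (f a) (f (c k)) by apply: fadj.
have bc k : adj (f b) (f (c k)) by apply: fadj.
pose c0 := @Ordinal 3 0 isT; pose c1 := @Ordinal 3 1 isT; pose c2 := @Ordinal 3 2 isT.
have n01 : f (c c0) != f (c c1) by apply: cinj.
have n02 : f (c c0) != f (c c2) by apply: cinj.
have n12 : f (c c1) != f (c c2) by apply: cinj.
have m2 : 2 < m by apply: ltn_trans m4.
move: ab (ac c0) (ac c1) (ac c2) (bc c0) (bc c1) (bc c2) n01 n02 n12.
move: (f a) (f b) (f (c c0)) (f (c c1)) (f (c c2)) => {c0 c1 c2 bc ac a b cinj c fadj finj f}.
have hubs (h : dunion (complete 1) (complete 1)) (i : 'I_m) (y0 y1 y2 : double_wheel m) :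
    adj (inl h : double_wheel m) y0 -> adj (inl h : double_wheel m) y1 ->
    adj (inl h : double_wheel m) y2 -> adj (inr i : double_wheel m) y0 ->
    adj (inr i : double_wheel m) y1 -> adj (inr i : double_wheel m) y2 ->
    y0 != y1 -> y0 != y2 -> y1 != y2 -> False.
  have noh h' : adj (inl h : double_wheel m) (inl h') -> False.
    by case: h h' => h [] h' //=; rewrite /complete_rel !ord1 eqxx.
  case: y0 y1 y2 => [h0|j0] [h1|j1] [h2|j2] //; try by [move=> /noh|move=> _ /noh|move=> _ _ /noh].
  move=> _ _ _; rewrite ![adj _ _]cycle_adjE //.
  have E (j j' : 'I_m) : (inr j : double_wheel m) != inr j' -> (j != j' :> nat).
    by apply: contra => /eqP/val_inj->.
  case: i j0 j1 j2 E => [i im] [j0 j0m] [j1 j1m] [j2 j2m] E h0 h1 h2 /E/= n1 /E/= n2 /E/= n3.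
  by move: h0 h1 h2 n1 n2 n3 => /=; clear E noh; lia.
case=> [h|i] [h'|j] y0 y1 y2 ab a0 a1 a2 b0 b1 b2 n01 n02 n12.
- by case: h h' ab {a0 a1 a2 b0 b1 b2} => h [] h' //=; rewrite /complete_rel !ord1 eqxx.
- exact: (@hubs h j y0 y1 y2).
- exact: (@hubs h' i y0 y1 y2).
have noj k : adj (inr i : double_wheel m) (inr k) -> adj (inr j : double_wheel m) (inr k) -> False.
  move: ab; rewrite /= ![cycle_rel _ _](cycle_adjE (m := m)) //.
  by case: i j k {a0 a1 a2 b0 b1 b2} => [i im] [j jm] [k km] /=; lia.
case: y0 a0 b0 n01 n02 => [h0|k0] a0 b0; last by case: (noj k0).
case: y1 a1 b1 n12 => [h1|k1] a1 b1; last by case: (noj k1).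
case: y2 a2 b2 => [h2|k2] a2 b2; last by case: (noj k2).
case: h0 {a0 b0} => h0; case: h1 {a1 b1} => h1; case: h2 {a2 b2} => h2;
  by rewrite !ord1 ?eqxx.
Qed.

Local Open Scope ring_scope.
Local Open Scope classical_set_scope.

Section Drawing.
Variables (R : realType) (m : nat).
Hypothesis m4 : (4 < m)%N.
Let G := double_wheel m.

(** The rim lies on the horizontal axis between the two hubs. The closing edge is the graph of
    [parabola], which passes above the upper hub because its value at 1 is m - 2. *)
Definition wheel_pos (x : G) : R * R :=
  match x with inl (inl _) => (1, 1) | inl (inr _) => (1, -1) | inr i => (i%:R, 0) end.

Definition closing (x y : G) : bool :=
  match x, y with
  | inr i, inr j => ((i == 0%N :> nat) && (j.+1 == m)) || ((j == 0%N :> nat) && (i.+1 == m))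
  | _, _ => false
  end.

Definition line (a b t : R) : R := (1 - t) * a + t * b.

Definition parabola (a : R) : R := a * (m.-1%:R - a).

Definition wheel_curve (x y : G) (t : R) : R * R :=
  let a := line (wheel_pos x).1 (wheel_pos y).1 t in
  (a, if closing x y then parabola a else line (wheel_pos x).2 (wheel_pos y).2 t).

Definition wheel_arc (S : {set G}) : set (R * R) :=
  [set p | exists x y t, [/\ S = [set x; y]%SET, 0 <= t <= 1 & p = wheel_curve x y t]].

Lemma closingC x y : closing x y = closing y x.
Proof. by case: x y => [h|i] [h'|j] //=; rewrite orbC. Qed.

Lemma wheel_curveC x y t : wheel_curve y x t = wheel_curve x y (1 - t).
Proof.
rewrite /wheel_curve closingC.
have e a b : line b a t = line a b (1 - t) by rewrite /line; ring.
by rewrite !(e (wheel_pos x).1) !(e (wheel_pos x).2).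
Qed.

Lemma wheel_arcE x y (p : R * R) : wheel_arc [set x; y]%SET p ->
  exists2 t, 0 <= t <= 1 & p = wheel_curve x y t.
Proof.
case=> x' [y' [t [/setP e t01 ->]]].
have hx : (x == x') || (x == y') by move: (e x); rewrite !inE eqxx.
have hy : (y == x') || (y == y') by move: (e y); rewrite !inE eqxx orbT.
have hx' : (x' == x) || (x' == y) by move: (e x'); rewrite !inE eqxx.
have hy' : (y' == x) || (y' == y) by move: (e y'); rewrite !inE eqxx orbT.
case/orP: hx' hx hy => /eqP->; case/orP: hy' => /eqP-> hx hy.
- by move: hy; rewrite orbb => /eqP->; exists t.
- by exists t.
- by exists (1 - t); [lra|exact: wheel_curveC].
- by move: hx; rewrite orbb => /eqP->; exists t.
Qed.

(** The kinds of edges, each oriented. [on] describes a drawn edge by its equation, without the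
    curve parameter, so that intersections are found by comparing coordinates. *)
Inductive wedge := Upper of 'I_m | Lower of 'I_m | Rim of 'I_m & 'I_m | Closing of 'I_m & 'I_m.

Definition wedge_ends (e : wedge) : G * G :=
  match e with
  | Upper i => (inl (inl ord0), inr i)
  | Lower i => (inl (inr ord0), inr i)
  | Rim i j | Closing i j => (inr i, inr j)
  end.

Definition on (e : wedge) (p : R * R) : Prop :=
  match e with
  | Upper i => [/\ 0 <= p.2, p.2 <= 1 & p.1 = i%:R + p.2 * (1 - i%:R)]
  | Lower i => [/\ -1 <= p.2, p.2 <= 0 & p.1 = i%:R - p.2 * (1 - i%:R)]
  | Rim i j => [/\ j = i.+1 :> nat, p.2 = 0 & i%:R <= p.1 <= j%:R]
  | Closing i j => [/\ i = 0%N :> nat, j.+1 = m, 0 <= p.1 <= m.-1%:R & p.2 = parabola p.1]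
  end.

Definition oriented (x y : G) : bool :=
  match x, y with
  | inl _, _ => true
  | inr _, inl _ => false
  | inr i, inr j => (i.+1 == j :> nat) || (i == 0%N :> nat) && (j.+1 == m)
  end.

Lemma adj_wedge x y t : adj x y -> 0 <= t <= 1 -> exists e, on e (wheel_curve x y t) /\
  (wedge_ends e = (x, y) \/ wedge_ends e = (y, x)).
Proof.
wlog : x y t / oriented x y.
  move=> W xy t01.
  have flip : oriented y x ->
      exists e, on e (wheel_curve x y t) /\ (wedge_ends e = (x, y) \/ wedge_ends e = (y, x)).
    move=> h; have [||e [he1 he2]] := W y x (1 - t) h; rewrite 1?adj_sym //; first by lra.
    exists e; move: he1; rewrite wheel_curveC subKr => he1; split=> //; by case: he2; auto.
  case: x y xy W flip => [h|i] [h'|j] xy W flip; try by [apply: W|apply: flip].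
  have := xy; rewrite /= [cycle_rel _ _](cycle_adjE (m := m)) ?(ltn_trans _ m4) //.
  case/or4P => h.
  - by apply: W => //; rewrite /oriented h.
  - by apply: flip; rewrite /oriented h.
  - by apply: W => //; rewrite /oriented h orbT.
  - by apply: flip; rewrite /oriented h orbT.
case: x y => [[h|h]|i] [[h'|h']|j] //= cond xy t01.
- by move: xy; rewrite /complete_rel !ord1 eqxx.
- exists (Upper j); rewrite /= /line /=; split; last by left; rewrite !ord1.
  by split; rewrite /=; [lra|lra|ring].
- by move: xy; rewrite /complete_rel !ord1 eqxx.
- exists (Lower j); rewrite /= /line /=; split; last by left; rewrite !ord1.
  by split; rewrite /=; [lra|lra|ring].
case/orP: cond => [/eqP ij|/andP[/eqP i0 jm]].
  exists (Rim i j); rewrite /wheel_curve /= /line; split; last by left.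
  have -> : ((i == 0%N :> nat) && (j.+1 == m)) || ((j == 0%N :> nat) && (i.+1 == m)) = false.
    by move: ij m4; lia.
  split => //=; first by ring.
  have : (i%:R : R) + 1 = j%:R by rewrite -ij -natr1.
  by move=> <-; lra.
exists (Closing i j); rewrite /wheel_curve /= /line i0 jm /=; split; last by left.
have -> : m.-1 = j by rewrite -(congr1 predn (eqP jm)).
have j0 : 0 <= (j%:R : R) by [].
split=> //=; first exact/eqP.
have := mulr_ge0 (proj1 (andP t01)) j0.
have h1 : 0 <= 1 - t by lra.
have := mulr_ge0 h1 j0; lra.
Qed.

Lemma on_pos e z : on e (wheel_pos z) -> z = (wedge_ends e).1 \/ z = (wedge_ends e).2.
Proof.
have m1 : (4 : R) <= m.-1%:R by rewrite ler_nat; move: m4; lia.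
have nateq (a b : 'I_m) : (a%:R : R) = b%:R -> a = b.
  by move=> /eqP; rewrite eqr_nat => /eqP/val_inj.
case: e => [i|i|i j|i j]; case: z => [[h|h]|k] /=; rewrite /parabola.
- by move=> _; left; rewrite !ord1.
- by case=> h1 h2 h3; exfalso; lra.
- by case=> _ _; rewrite mul0r addr0 => /nateq->; right.
- by case=> h1 h2 h3; exfalso; lra.
- by move=> _; left; rewrite !ord1.
- by case=> _ _; rewrite mul0r subr0 => /nateq->; right.
- by case=> h1 h2 h3; exfalso; lra.
- by case=> h1 h2 h3; exfalso; lra.
- case=> ij _; rewrite !ler_nat ij => /andP[h1 h2].
  have [e|e] : k = i :> nat \/ k = j :> nat by lia.
    by left; congr inr; apply: val_inj.
  by right; congr inr; apply: val_inj.
- by case=> h1 h2 h3 h4; exfalso; lra.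
- by case=> h1 h2 h3 h4; exfalso; lra.
- case=> i0 jm h3 /esym/eqP; rewrite mulf_eq0 subr_eq0 !(eqr_nat, pnatr_eq0) => /orP[/eqP k0|/eqP km].
    by left; congr inr; apply: val_inj; rewrite /= k0 i0.
  by right; congr inr; apply: val_inj; rewrite /= -km -(congr1 predn jm).
Qed.

Lemma on_axis e p : on e p -> p.2 = 0 ->
  (exists i j, e = Rim i j) \/ range wheel_pos p.
Proof.
case: p => a b; case: e => [i|i|i j|i j] /= + b0; rewrite ?b0 ?mul0r ?addr0 ?subr0.
- by case=> _ _ ->; right; exists (inr i).
- by case=> _ _ ->; right; exists (inr i).
- by move=> _; left; exists i, j.
- case=> i0 jm _ /esym/eqP; rewrite /parabola mulf_eq0 subr_eq0 => /orP[/eqP->|/eqP<-].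
    by right; exists (inr i) => //=; rewrite i0.
  by right; exists (inr j) => //=; rewrite -(congr1 predn jm).
Qed.

(** On the axis there are only rim edges and vertices. Off the axis, the sign of the height
    separates the lower spokes from all other edges, two spokes at one hub meet only in that hub,
    and the parabola stays above the upper spokes. *)
Lemma on_meet e e' p : on e p -> on e' p -> e = e' \/ range wheel_pos p.
Proof.
move=> he he'; have [b0|b0] := eqVneq p.2 0.
  have [[i [j eE]]|] := on_axis he b0; last by right.
  have [[i' [j' e'E]]|] := on_axis he' b0; last by right.
  rewrite {}eE {}e'E in he he' *; case: he he' => ij _ h [ij' _ h'].
  have vinj (k l : 'I_m) : k = l :> nat -> k = l by exact: val_inj.
  have [lt|lt|eqii] := ltngtP i i'.
  - right; exists (inr i') => //=; case: p b0 h h' => a b /= -> h h'; congr (_, _).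
    have : (j%:R : R) <= i'%:R by rewrite ler_nat ij.
    lra.
  - right; exists (inr i) => //=; case: p b0 h h' => a b /= -> h h'; congr (_, _).
    have : (j'%:R : R) <= i%:R by rewrite ler_nat ij'.
    lra.
  - by left; congr Rim; apply: vinj => //; rewrite ij ij' eqii.
have m1 : (4 : R) <= m.-1%:R by rewrite ler_nat; move: m4; lia.
have vinj (k l : 'I_m) : (k%:R : R) = l%:R -> k = l.
  by move=> /eqP; rewrite eqr_nat => /eqP/val_inj.
have par_ge0 (a : R) : 0 <= a <= m.-1%:R -> 0 <= parabola a.
  by move=> h; apply: mulr_ge0; lra.
(* Concavity: the parabola lies above the segments from the upper hub. *)
have conc (i : 'I_m) (a b : R) : 0 < b -> b <= 1 -> a = i%:R + b * (1 - i%:R) ->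
    b = parabola a -> False.
  move=> h0 h1 -> E.
  have : parabola (i%:R + b * (1 - i%:R)) =
      (1 - b) * parabola i%:R + b * parabola 1 + b * (1 - b) * (i%:R - 1) ^+ 2.
    by rewrite /parabola; ring.
  rewrite -E => {}E.
  have hi : 0 <= parabola i%:R.
    by apply: par_ge0; rewrite ler0n ler_nat; have := ltn_ord i; move: m4; lia.
  have t1 : 0 <= (1 - b) * parabola i%:R by apply: mulr_ge0 => //; lra.
  have t2 : 0 <= b * (1 - b) * (i%:R - 1) ^+ 2.
    by apply: mulr_ge0; [apply: mulr_ge0; lra|exact: sqr_ge0].
  have : b * 2 <= b * parabola 1 by rewrite ler_pM2l // /parabola; lra.
  lra.
case: p b0 he he' => a b /= b0.
case: e => [i|i|i j|i j]; case: e' => [i'|i'|i' j'|i' j'] /=; rewrite ?(negPf b0).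
- case=> h1 h2 h3 [_ _ h4].
  have /eqP : (1 - b) * (i%:R - i'%:R) = 0 by move: h4; rewrite h3; lra.
  rewrite mulf_eq0 !subr_eq0 => /orP[/eqP b1|/eqP/vinj->]; last by left.
  by right; exists (inl (inl ord0)) => //=; rewrite h3 -b1; congr (_, _); ring.
- by case=> h1 h2 _ [h3 h4 _]; case/eqP: b0; lra.
- by move=> _ [_ e0]; case/eqP: b0.
- by case=> h1 h2 h3 [_ _ _ h4]; case: (@conc i a b) => //; rewrite lt_neqAle eq_sym b0.
- by case=> h1 h2 _ [h3 h4 _]; case/eqP: b0; lra.
- case=> h1 h2 h3 [_ _ h4].
  have /eqP : (1 + b) * (i%:R - i'%:R) = 0 by move: h4; rewrite h3; lra.
  rewrite mulf_eq0 subr_eq0 addr_eq0 => /orP[/eqP b1|/eqP/vinj->]; last by left.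
  have bE : b = -1 by lra.
  by right; exists (inl (inr ord0)) => //=; rewrite h3 bE; congr (_, _); ring.
- by move=> _ [_ e0]; case/eqP: b0.
- by case=> h1 h2 h3 [_ _ /par_ge0 h4 h5]; case/eqP: b0; lra.
- by case=> _ e0; case/eqP: b0.
- by case=> _ e0; case/eqP: b0.
- by case=> _ e0; case/eqP: b0.
- by case=> _ e0; case/eqP: b0.
- by case=> _ _ _ h4 [h1 h2 h3]; case: (@conc i' a b) => //; rewrite lt_neqAle eq_sym b0.
- by case=> _ _ /par_ge0 h4 h5 [h1 h2 _]; case/eqP: b0; lra.
- by move=> _ [_ e0]; case/eqP: b0.
- case=> i0 jm _ _ [i0' jm' _ _]; left; congr Closing; apply: val_inj => //=.
    by rewrite i0.
  by apply: succn_inj; rewrite jm.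
Qed.

Lemma wheel_pos_inj : injective wheel_pos.
Proof.
move=> x y e; have e1 := congr1 fst e; have e2 := congr1 snd e.
case: x y e1 e2 {e} => [[h|h]|i] [[h'|h']|j] /= e1 e2; rewrite ?ord1 //; try by exfalso; lra.
by move/eqP: e1; rewrite eqr_nat => /eqP/val_inj->.
Qed.

Lemma wheel_curve_inj x y : adj x y -> {in `[0, 1]%R &, injective (wheel_curve x y)}.
Proof.
move=> xy t t' _ _ []; rewrite /line => h1 h2.
have nxy : x <> y by move=> e; rewrite e adj_irrefl in xy.
have lin (a b : R) : a != b -> (1 - t) * a + t * b = (1 - t') * a + t' * b -> t = t'.
  move=> ab h; apply/eqP; rewrite -subr_eq0.
  have /eqP : (t - t') * (b - a) = 0 by lra.
  by rewrite mulf_eq0 => /orP[//|/eqP h']; case/eqP: ab; lra.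
have [e1|] := eqVneq (wheel_pos x).1 (wheel_pos y).1; last by move/lin/(_ h1).
have [e2|ne2] := eqVneq (wheel_pos x).2 (wheel_pos y).2.
  by case: nxy; apply: wheel_pos_inj; case: (wheel_pos x) (wheel_pos y) e1 e2 => ? ? [? ?] /= -> ->.
case cl: (closing x y) h2 => h2; last exact: lin ne2 h2.
by move: cl ne2; case: (x) (y) => [?|?] [?|?] //=; rewrite eqxx.
Qed.

Lemma wheel_planar : planar R G.
Proof.
exists wheel_pos, wheel_arc; split; first exact: wheel_pos_inj.
- move=> x y xy; exists (wheel_curve x y); split.
  + apply: continuous_subspaceT => t.
    have cl (a b : R) : {for t, continuous (line a b)}.
      apply: cvgD; first by apply: cvgMl; apply: cvgB; [exact: cvg_cst|exact: cvg_id].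
      by apply: cvgMl; exact: cvg_id.
    have c1 := cl (wheel_pos x).1 (wheel_pos y).1.
    have c2 := cl (wheel_pos x).2 (wheel_pos y).2.
    rewrite /wheel_curve; case: (closing x y); last exact: cvg_pair c1 c2.
    have c3 : parabola (line (wheel_pos x).1 (wheel_pos y).1 r) @[r --> t] -->
        parabola (line (wheel_pos x).1 (wheel_pos y).1 t).
      by apply: cvgM; [exact: c1|apply: cvgB; [exact: cvg_cst|exact: c1]].
    exact: cvg_pair c1 c3.
  + exact: wheel_curve_inj.
  + have nc : closing x y -> parabola (wheel_pos x).1 = (wheel_pos x).2.
      case: (x) (y) => [h|i] [h'|j] //=; rewrite /parabola.
      move=> /orP[/andP[/eqP-> _]|/andP[_ /eqP im]]; first by rewrite mul0r.
      by rewrite -(congr1 predn im) subrr mulr0.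
    rewrite /wheel_curve /line !(subr0, mul1r, mul0r, addr0).
    by case cl: (closing x y); rewrite ?nc //; case: (wheel_pos x).
  + have nc : closing x y -> parabola (wheel_pos y).1 = (wheel_pos y).2.
      case: (x) (y) => [h|i] [h'|j] //=; rewrite /parabola.
      move=> /orP[/andP[_ /eqP im]|/andP[/eqP-> _]]; last by rewrite mul0r.
      by rewrite -(congr1 predn im) subrr mulr0.
    rewrite /wheel_curve /line !(subrr, mul1r, mul0r, add0r).
    by case cl: (closing x y); rewrite ?nc //; case: (wheel_pos y).
  + apply/seteqP; split=> p.
      by move=> /wheel_arcE[t t01 ->]; exists t; rewrite //= in_itv.
    by case=> t /=; rewrite in_itv /= => t01 <-; exists x, y, t.
- move=> x y z xy /wheel_arcE[t t01 E].
  have [e [one ends]] := adj_wedge xy t01.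
  by rewrite -E in one; have := on_pos one; case: ends => -> /= []; auto.
- move=> x y u v xy uv ne p [/wheel_arcE[t t01 E] /wheel_arcE[t' t01' E']].
  have [e [one ends]] := adj_wedge xy t01; have [e' [one' ends']] := adj_wedge uv t01'.
  rewrite -E in one; rewrite -E' in one'.
  have [ee|//] := on_meet one one'.
  case/eqP: ne; move: ends ends'; rewrite ee.
  by move=> [->|->] [[-> ->]|[-> ->]] //; rewrite finset.setUC.
Qed.

End Drawing.

End WheelDrawing.

(** * Spectral radii *)

Section SpectralRadius.

Local Open Scope ring_scope.

Section Isomorphism.
Variable R : realType.

Lemma planar_iso (G H : sgraph) : sgraph_iso G H -> planar R H -> planar R G.
Proof.
case=> f bf hf [pos [arc [h1 h2 h3 h4]]].
have finj := bij_inj bf.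
have im x y : (f @: [set x; y])%SET = [set f x; f y]%SET by rewrite imsetU1 imset_set1.
exists (pos \o f), (fun S : {set G} => arc (f @: S)%SET); split.
- exact: inj_comp.
- by move=> x y xy; rewrite im; apply: h2; rewrite hf.
- move=> x y z xy; rewrite im /= => h.
  by have := h3 (f x) (f y) (f z); rewrite hf => /(_ xy h)[]/finj; auto.
- move=> x y u v xy uv ne; rewrite !im => p hp.
  have [||| q _ <-] := h4 (f x) (f y) (f u) (f v) _ _ _ p hp; rewrite ?hf //.
    by rewrite -!im; apply: contra ne => /eqP/(imset_inj finj)->.
  by case: bf => g _ gK; exists (g q) => //=; rewrite gK.
Qed.

Lemma free_iso (F G H : sgraph) : sgraph_iso G H -> is_free F H -> is_free F G.
Proof.
case=> f bf hf free [g ginj gadj]; apply: free; exists (f \o g).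
  by apply: inj_comp => //; exact: bij_inj.
by move=> x y xy /=; rewrite hf gadj.
Qed.

Lemma eigenvalue_nsum (G : sgraph) (a : R) : eigenvalue (adjacency R G) a <->
  exists y : G -> R, (exists x, y x != 0) /\ forall x, nsum y [set: G] x = a * y x.
Proof.
split.
  move/eigenvalueP => [v vA v0].
  exists (fun x => v 0 (enum_rank x)); split.
    have [i vi] : exists i, v 0 i != 0.
      apply/existsP; apply: contraT => /existsPn h; case/negP: v0; apply/eqP/rowP => i.
      by rewrite mxE; have := h i; rewrite negbK => /eqP.
    by exists (enum_val i); rewrite enum_valK.
  move=> x; move/rowP/(_ (enum_rank x)): vA; rewrite !mxE => <-.
  rewrite /nsum (reindex (@enum_val G predT)) /=; last first.
    by apply: onW_bij; exact: enum_val_bij.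
  rewrite [RHS](eq_bigl (fun i => enum_val i \in [set: G])); last by move=> i; rewrite inE.
  by apply: eq_bigr => i _; rewrite mxE enum_valK enum_rankK adjrC mulrC.
case=> y [[x yx] hy]; apply/eigenvalueP; exists (\row_j y (enum_val j)).
  apply/rowP => j; rewrite !mxE -hy /nsum (reindex (@enum_val G predT)) /=; last first.
    by apply: onW_bij; exact: enum_val_bij.
  rewrite [RHS](eq_bigl predT); last by move=> i; rewrite inE.
  by apply: eq_bigr => i _; rewrite !mxE adjrC mulrC.
apply/eqP => /rowP/(_ (enum_rank x)); rewrite !mxE enum_rankK => e.
by rewrite e eqxx in yx.
Qed.

Lemma eigenvalue_iso (G H : sgraph) (a : R) : sgraph_iso G H ->
  eigenvalue (adjacency R G) a -> eigenvalue (adjacency R H) a.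
Proof.
case=> f [g fK gK] hf /eigenvalue_nsum[y [[x yx] hy]]; apply/eigenvalue_nsum.
exists (y \o g); split; first by exists (f x); rewrite /= fK.
move=> w; rewrite /= -hy /nsum (reindex f) /=; last by apply: onW_bij; exists g.
apply: eq_big => [i|i _]; first by rewrite !inE.
by rewrite fK /adjr -hf gK.
Qed.

Lemma iso_sym (G H : sgraph) : sgraph_iso G H -> sgraph_iso H G.
Proof.
by case=> f [g fK gK] hf; exists g => [|x y]; [exists f|rewrite -hf !gK].
Qed.

Lemma spectral_radius_iso (G H : sgraph) : sgraph_iso G H ->
  spectral_radius R G = spectral_radius R H.
Proof.
move=> GH; congr (sup _); apply/seteqP; split=> a /=; first exact: eigenvalue_iso.
by apply: eigenvalue_iso; exact: iso_sym.
Qed.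

(** If every root were followed by a larger one, there would be more distinct roots than the degree
    allows. *)
Lemma max_root (p : {poly R}) (a : R) : p != 0 -> root p a ->
  exists2 b, root p b & forall c, root p c -> c <= b.
Proof.
move=> p0 pa; apply: contrapT => nomax.
have up b : root p b -> exists2 c, root p c & b < c.
  move=> pb; apply: contrapT => h; apply: nomax; exists b => // c pc.
  by rewrite leNgt; apply/negP => bc; apply: h; exists c.
have [s [x [ps us xs sz]]] : exists s x, [/\ all (root p) (x :: s), uniq (x :: s),
    all (fun y => y < x) s & size s = size p].
  elim: (size p) => [|k [s [x [/= /andP[px ps] /andP[xs us] lx sz]]]].
    by exists [::], a; rewrite /= pa.
  have [c pc xc] := up x px; exists (x :: s), c; split=> /=.
  - by rewrite pc px ps.
  - rewrite xs us !andbT inE negb_or gt_eqF //=.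
    apply/negP => cs; have := allP lx c cs; rewrite ltNge => /negP; apply; exact: ltW.
  - by rewrite xc /=; apply: sub_all lx => y /lt_trans; apply.
  - by rewrite sz.
by have := max_poly_roots p0 ps us; rewrite /= sz ltnNge leqnSn.
Qed.

(** Positivity of c excludes the empty spectrum, whose supremum is 0 by convention. *)
Lemma spectral_radius_attained (G : sgraph) (c : R) : 0 < c -> c <= spectral_radius R G ->
  exists2 a, eigenvalue (adjacency R G) a & c <= a.
Proof.
move=> c0 hc; have [[a ea]|none] := pselect (exists a, eigenvalue (adjacency R G) a).
  have p0 : char_poly (adjacency R G) != 0 by rewrite monic_neq0 // char_poly_monic.
  have [|b pb bmax] := max_root (a := a) p0; first by rewrite -eigenvalue_root_char.
  exists b; first by rewrite eigenvalue_root_char.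
  apply: le_trans hc _; apply: ge_sup; first by exists a.
  by move=> d /=; rewrite eigenvalue_root_char => /bmax.
move: hc; rewrite /spectral_radius.
have -> : [set a | eigenvalue (adjacency R G) a]%classic = set0.
  by apply/seteqP; split=> // a ea; case: none; exists a.
by rewrite sup0 leNgt c0.
Qed.

Lemma spectral_radius_le (G : sgraph) (c : R) : 0 <= c ->
  (forall a, eigenvalue (adjacency R G) a -> a <= c) -> spectral_radius R G <= c.
Proof.
move=> c0 h; have [[a ea]|none] := pselect (exists a, eigenvalue (adjacency R G) a).
  by apply: ge_sup; [exists a|move=> b /h].
rewrite /spectral_radius.
have -> : [set a | eigenvalue (adjacency R G) a]%classic = set0.
  by apply/seteqP; split=> // a ea; case: none; exists a.
by rewrite sup0.
Qed.

(** The eigenvector y is compared with the positive one at a vertex where |y| / x is largest. *)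
Lemma eigenvalue_le_positive (G : sgraph) (x : G -> R) (lam a : R) :
    (forall w, 0 < x w) -> (forall w, nsum x [set: G] w = lam * x w) ->
  eigenvalue (adjacency R G) a -> a <= lam.
Proof.
move=> x0 hx /eigenvalue_nsum[y [[w1 yw1] hy]].
pose w0 := [arg max_(i > w1) (`|y i| / x i)]%O.
have hw i : `|y i| / x i <= `|y w0| / x w0.
  by rewrite /w0; case: (arg_maxP (fun i => `|y i| / x i) (isT : predT w1)) => j _; apply.
set M := `|y w0| / x w0 in hw.
have yM i : `|y i| <= M * x i by rewrite -ler_pdivrMr.
have yE : `|y w0| = M * x w0 by rewrite /M divfK // gt_eqF.
have M0 : 0 < M by apply: lt_le_trans (hw w1); rewrite divr_gt0 // normr_gt0.
have y0 : 0 < `|y w0| by rewrite yE mulr_gt0.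
apply: le_trans (ler_norm a) _; rewrite -(ler_pM2r y0) -normrM -hy.
apply: le_trans (ler_norm_sum _ _ _) _.
have -> : lam * `|y w0| = \sum_(w in [set: G]) adjr R w0 w * (M * x w).
  rewrite yE mulrCA -hx /nsum mulr_sumr; apply: eq_bigr => w _; ring.
apply: ler_sum => w _; rewrite normrM ger0_norm ?ler0n //.
by apply: ler_wpM2l; [exact: ler0n|exact: yM].
Qed.

End Isomorphism.

Lemma succ_mod_inj m k l : (k < m)%N -> (l < m)%N -> (k.+1 %% m = l.+1 %% m)%N -> k = l.
Proof.
by move=> km lm; rewrite !succ_mod //; case: (k.+1 =P m) => h1; case: (l.+1 =P m) => h2; lia.
Qed.

Section WheelSpectrum.
Variables (R : realType) (m : nat) (lam : R).
Hypotheses (m2 : (2 < m)%N) (hl : 2 < lam) (hm : lam * (lam - 2) = 2 * m%:R).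
Let W := double_wheel m.

(** With weight 1 on both hubs, the rim weight t solves lam t = 2 + 2 t. *)
Definition wheel_vector (w : W) : R := if w is inr _ then 2 / (lam - 2) else 1.

Lemma cycle_deg (i : cycle_graph m) : \sum_(j : cycle_graph m) adjr R i j = 2.
Proof.
have im : (i < m)%N by exact: ltn_ord.
have [km ki ksi] := pred_mod m2 im; set k := if _ then _ else _ in km ki ksi.
have sm : (i.+1 %% m < m)%N by rewrite ltn_mod (leq_trans _ m2).
pose s : cycle_graph m := Ordinal sm; pose p : cycle_graph m := Ordinal km.
have sp : s != p by rewrite -val_eqE.
have ne j : i != j -> (j == s) || (j == p) = adj i j.
  move=> ij; rewrite /= /cycle_rel ij /= -!val_eqE /=; congr orb.
  apply/eqP/eqP => [->|h]; first by rewrite ki.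
  have {h} : (k.+1 %% m = j.+1 %% m)%N by rewrite ki.
  by move=> h; exact: (succ_mod_inj (ltn_ord j) km (esym h)).
have is_ : i != s by rewrite -val_eqE /= succ_mod //; case: (i.+1 =P m) => h; move: im m2; lia.
have ip : i != p by apply/eqP => e; move: is_; rewrite -val_eqE /= -{1}ki {1}e /= eqxx.
rewrite (bigD1 s) //= (bigD1 p) /=; last by rewrite eq_sym.
rewrite big1 => [|j /andP[js jp]].
  by rewrite /adjr -!ne // !eqxx orbT addr0.
have [->|ij] := eqVneq i j; first by rewrite /adjr adj_irrefl.
by rewrite /adjr -ne // (negPf js) (negPf jp).
Qed.

Lemma wheel_vector_gt0 w : 0 < wheel_vector w.
Proof. by case: w => [h|i] /=; rewrite ?divr_gt0 // subr_gt0. Qed.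

Lemma wheel_vectorE w : nsum wheel_vector [set: W] w = lam * wheel_vector w.
Proof.
have l2 : lam - 2 != 0 by rewrite gt_eqF // subr_gt0.
rewrite /nsum (eq_bigl predT); last by move=> i; rewrite inE.
rewrite big_sumType /= big_sumType /=.
have hub (h : dunion (complete 1) (complete 1)) :
    \sum_(j : 'I_m) adjr R (inl h : W) (inr j) * (2 / (lam - 2)) = lam.
  rewrite -mulr_suml /adjr /= sumr_const card_ord.
  have -> : m%:R = lam * (lam - 2) / 2 by rewrite hm; field.
  by field.
case: w => [h|i] /=.
  rewrite hub mulr1 !big_ord1 /adjr /=.
  by case: h => h /=; rewrite /complete_rel !ord1 /= !mul0r !add0r.
rewrite !big_ord1 /adjr /= !mul1r -mulr_suml.
have -> : \sum_(j : 'I_m) (cycle_rel i j)%:R = 2 :> R by exact: cycle_deg.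
by field.
Qed.

Lemma spectral_radius_wheel : spectral_radius R W = lam.
Proof.
have l0 : 0 < lam by apply: lt_trans hl.
have bound a : eigenvalue (adjacency R W) a -> a <= lam.
  exact: eigenvalue_le_positive wheel_vector_gt0 wheel_vectorE.
apply/le_anti; rewrite spectral_radius_le ?(ltW l0) //=.
have E : eigenvalue (adjacency R W) lam.
  apply/eigenvalue_nsum; exists wheel_vector; split; last exact: wheel_vectorE.
  have m0 : (0 < m)%N by apply: leq_trans m2.
  by exists (inr (Ordinal m0)); rewrite gt_eqF // wheel_vector_gt0.
apply: sup_upper_bound => //; split; first by exists lam.
by exists lam => a; exact: bound.
Qed.

End WheelSpectrum.

Lemma K33_free_of_crossing (G : sgraph) L M t : @crossing_data G L M t -> K33_free G.
Proof.
move=> LMt a b c ab ac bc; rewrite leqNgt; apply/negP => /card_gt2P.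
move=> [x [y [z [[]]]]]; rewrite !inE => /and3P[ax bx cx] /and3P[ay b_y cy] /and3P[az bz cz] [xy yz zx].
have ne (v w : G) : adj v w -> v != w by apply: contraTneq => ->; rewrite adj_irrefl.
apply: (no_K33 LMt (s := [:: a; b; c; x; y; z])) => //.
  rewrite /= !inE !negb_or ab ac bc xy yz [x == z]eq_sym zx.
  by rewrite !(ne _ _ ax, ne _ _ ay, ne _ _ az, ne _ _ bx, ne _ _ b_y, ne _ _ bz, ne _ _ cx,
    ne _ _ cy, ne _ _ cz).
by case=> [|[|[|i]]] [|[|[|[|[|[|j]]]]]] //.
Qed.

Lemma book_of_common (G : sgraph) (u v : G) p : adj u v ->
  (p <= #|[set r | adj u r && adj v r]|)%N -> contains (book p) G.
Proof.
move=> uv; set C := [set r | _] => pC.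
have rim (k : 'I_p) : enum_val (widen_ord pC k) \in C by exact: enum_valP.
pose f (x : book p) : G := match x with
  | inl i => if i == ord0 then u else v
  | inr k => enum_val (widen_ord pC k) end.
have uC : u \notin C by rewrite inE adj_irrefl.
have vC : v \notin C by rewrite inE adj_irrefl andbF.
have ne : u != v by apply: contraTneq uv => ->; rewrite adj_irrefl.
have i01 (i : 'I_2) : i != ord0 -> i = ord_max.
  by case: i => [[|[|]]] // h _; apply: val_inj.
exists f.
  case=> [i|k] [j|l] /=.
  - have [->|/i01->] := eqVneq i ord0; have [->|/i01->] := eqVneq j ord0 => //= e.
      by rewrite e eqxx in ne.
    by rewrite e eqxx in ne.
  - case: eqP => _ e; [case/negP: uC|case/negP: vC]; rewrite e; exact: rim.
  - case: eqP => _ e; [case/negP: uC|case/negP: vC]; rewrite -e; exact: rim.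
  - by move/enum_val_inj/(congr1 val) => /= e; congr inr; apply: val_inj.
have uk k : adj u (enum_val (widen_ord pC k)) by have := rim k; rewrite inE => /andP[].
have vk k : adj v (enum_val (widen_ord pC k)) by have := rim k; rewrite inE => /andP[].
case=> [i|k] [j|l] //=.
- rewrite /complete_rel.
  case: (altP (i =P ord0)) => [->|/i01->]; case: (altP (j =P ord0)) => [->|/i01->] //= _.
  by rewrite adj_sym.
- by move=> _; case: ifP.
- by move=> _; rewrite adj_sym; case: ifP.
Qed.

Section Extremal.
Variables (R : realType) (p : nat).

(** This is [eta] in [two_hubs]: 24 eta is 1 / 10^4, the share of exceptional vertices that
    [hub_structure] admits. *)
Definition small : R := (24 * (100 * 100))^-1.
(** With c = small / 30, both 15 c and hub_eps / c equal small / 2. *)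
Definition hub_eps : R := small / 30 * small / 2.
(** A sum of nonnegative terms, so that lam is at least each of them; p%:R provides the pages of the
    book. *)
Definition threshold : R :=
  200 * 100 + p%:R + 30 / hub_eps / small + 2 * (30 / hub_eps) ^+ 4 / small.

Lemma extremal_structure (G : sgraph) (lam a : R) :
    threshold <= lam -> lam * (lam - 2) = 2 * (#|G|%:R - 2) ->
    planar R G -> is_free (book p) G -> eigenvalue (adjacency R G) a -> lam <= a ->
  sgraph_iso G (double_wheel (#|G| - 2)).
Proof.
move=> hl hn /planar_crossing_data[L [M [t LMt]]] free /eigenvalue_nsum[y [[x0 yx0] hy]] la.
have s0 : 0 < small by rewrite invr_gt0.
have e0 : 0 < hub_eps by rewrite /hub_eps !(divr_gt0, mulr_gt0).
have t1 : 0 <= 30 / hub_eps / small by rewrite !divr_ge0 // ltW.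
have t2 : 0 <= 2 * (30 / hub_eps) ^+ 4 / small.
  by rewrite divr_ge0 ?(ltW s0) // mulr_ge0 // exprn_ge0 // divr_ge0 // ltW.
have p0 : 0 <= p%:R :> R by exact: ler0n.
have [l1 [lp [l3 l4]]] : [/\ 200 * 100 <= lam, p%:R <= lam, 30 / hub_eps / small <= lam
    & 2 * (30 / hub_eps) ^+ 4 / small <= lam] by move: hl; rewrite /threshold; split; lra.
have lam0 : 0 < lam by lra.
have k33 := K33_free_of_crossing LMt.
have dg : degenerate_by 15 G by exact: degenerate LMt.
pose z x := `|y x|.
have z0 x : 0 <= z x by exact: normr_ge0.
have zn0 : exists x, z x != 0 by exists x0; rewrite normr_eq0.
have hz x : lam * z x <= nsum z [set: G] x.
  apply: (@le_trans _ _ (a * z x)); first exact: ler_wpM2r.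
  rewrite /z -{1}[a]gtr0_norm ?(lt_le_trans lam0) // -normrM -hy.
  apply: le_trans (ler_norm_sum _ _ _) _; apply: ler_sum => w _.
  by rewrite normrM ger0_norm ?ler0n.
have lsq : 200 * 100 * lam <= lam ^+ 2 by rewrite expr2 ler_pM2r.
have [u [v [uv hD]]] : exists u v : G, u != v /\
    #|[set r | ~~ (adj u r && adj v r)]|%:R <= lam ^+ 2 / (100 * 100).
  have E : lam ^+ 2 / (100 * 100) = (100 * 100)^-1 * lam ^+ 2 by rewrite mulrC.
  rewrite E; apply: (@two_hubs _ _ z lam hub_eps (small / 30) small) => //.
  - by rewrite divr_gt0.
  - have -> : hub_eps / (small / 30) = small / 2.
      by rewrite /hub_eps; field; rewrite gt_eqF.
    lra.
  - rewrite /small; lra.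
  - lra.
  - lra.
  - by move: l3; rewrite ler_pdivrMr // [lam * _]mulrC.
  - move: l4; rewrite ler_pdivrMr // => h; apply: le_trans h _; rewrite mulrC ler_pM2l //; lra.
  - lra.
(* The common neighbours of u and v are all but lam^2 / 10^4 of about lam^2 / 2 vertices, hence at
   least p; an edge uv would complete a book. *)
have nuv : ~~ adj u v.
  apply/negP => auv; apply: free; apply: (book_of_common auv).
  have : (#|[set r | adj u r && adj v r]| + #|[set r | ~~ (adj u r && adj v r)]|)%:R = #|G|%:R :> R.
    rewrite -[in RHS](cardsC [set r | adj u r && adj v r]); congr (_ + _)%:R.
    by apply: eq_card => r; rewrite !inE.
  rewrite natrD => hc; rewrite -(ler_nat R); lra.
have hub := hub_structure uv nuv l1 hn k33 dg z0 zn0 hz hD.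
apply: (wheel_iso uv nuv) => //.
  by move=> s cs sz; exact: (no_K5_minor LMt cs sz).
rewrite -(ltr_nat R); have : 0 < lam * (lam - 2) by rewrite mulr_gt0 //; lra.
lra.
Qed.

End Extremal.

End SpectralRadius.

Local Open Scope ring_scope.

Theorem theorem1p4 (R : realType) (p : nat) (hp : (3 <= p)%N) :
  exists N : nat, forall n : nat, (N <= n)%N ->
    forall G : sgraph,
      SPEX_P R n (book p) G <->
      sgraph_iso G
        (join (dunion (complete 1) (complete 1)) (cycle_graph (n - 2)%N)).
Proof.
(* This gives threshold^2 <= 2 n - 3, hence threshold <= lam, and the summand 7 makes the rim longer
   than 4. *)
exists (Num.truncn (threshold R p ^+ 2) + 7)%N => n hn G.
rewrite -/(double_wheel (n - 2)).
have n7 : (7 <= n)%N by apply: leq_trans hn; rewrite leq_addl.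
have m4 : (4 < n - 2)%N by lia.
have nR : (7 : R) <= n%:R by rewrite ler_nat.
pose lam : R := 1 + Num.sqrt (2 * n%:R - 3).
have sq : Num.sqrt (2 * n%:R - 3) ^+ 2 = 2 * n%:R - 3 :> R by rewrite sqr_sqrtr //; lra.
have lamE : lam * (lam - 2) = 2 * (n%:R - 2).
  have -> : lam * (lam - 2) = Num.sqrt (2 * n%:R - 3) ^+ 2 - 1 by rewrite /lam; ring.
  by rewrite sq; ring.
have lamT : threshold R p <= lam.
  have h : threshold R p ^+ 2 <= 2 * n%:R - 3.
    have := truncnS_gt (threshold R p ^+ 2).
    have : ((Num.truncn (threshold R p ^+ 2)).+1%:R : R) <= n%:R by rewrite ler_nat; lia.
    lra.
  apply: le_trans (ler_norm _) _; rewrite -sqrtr_sqr; apply: le_trans (ler_wsqrtr h) _.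
  by rewrite lerDr.
have lam2 : 2 < lam.
  have : 2 <= Num.sqrt (2 * n%:R - 3) :> R.
    have e2 : 2 = Num.sqrt (2 ^+ 2) :> R by rewrite sqrtr_sqr ger0_norm.
    by rewrite [X in X <= _]e2; apply: ler_wsqrtr; lra.
  rewrite /lam; lra.
have m2 : (2 < n - 2)%N by apply: ltn_trans m4.
have rhoW : spectral_radius R (double_wheel (n - 2)) = lam.
  by apply: spectral_radius_wheel => //; rewrite lamE natrB // (leq_trans _ n7).
have cardW : #|double_wheel (n - 2)| = n by rewrite !card_sum !card_ord; lia.
have planarW := wheel_planar R m4.
have freeW := book_free_wheel m4 hp.
have structure (H : sgraph) a : #|H| = n -> planar R H -> is_free (book p) H ->
    eigenvalue (adjacency R H) a -> lam <= a -> sgraph_iso H (double_wheel (n - 2)).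
  move=> cH plH frH ea la; rewrite -cH.
  by apply: (extremal_structure lamT) ea la => //; rewrite cH.
split.
  case=> cG plG frG maxG.
  have := maxG _ cardW planarW freeW; rewrite rhoW => hG.
  have [|a ea la] := spectral_radius_attained _ hG; first by apply: lt_trans lam2.
  exact: structure ea la.
move=> iso; split.
- by case: iso => f bf _; rewrite (bij_eq_card bf) cardW.
- exact: planar_iso planarW.
- exact: free_iso freeW.
- move=> H cH plH frH; rewrite (spectral_radius_iso R iso) rhoW.
  apply: spectral_radius_le => [|a ea]; first by apply/ltW/(lt_trans _ lam2).
  (* An eigenvalue above lam would make H the double wheel, all of whose eigenvalues are at most
     lam. *)
  rewrite leNgt; apply/negP => la.
  have HW := structure H a cH plH frH ea (ltW la).
  have lam0 : 0 <= lam by apply/ltW/(lt_trans _ lam2).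
  have := eigenvalue_iso HW ea => eW.
  have : a <= spectral_radius R (double_wheel (n - 2)).
    have mE : lam * (lam - 2) = 2 * (n - 2)%:R by rewrite lamE natrB // (leq_trans _ n7).
    rewrite rhoW; apply: (eigenvalue_le_positive (x := @wheel_vector R (n - 2) lam)) eW.
      exact: wheel_vector_gt0.
    exact: wheel_vectorE.
  by rewrite rhoW leNgt la.
Qed.
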